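(* Let $\mathcal V$ be a commutative variety of algebras and $\mathcal W$ a $\mathrm{Set}$-based operad. Let $\mathcal U$ be the variety of algebras consisting of the $\mathcal W$-algebras in $(\mathcal V,\boxdot,F_{\mathcal V}(\{*\}))$, let $\mathcal U^{c}$ be the category of co-$\mathcal U$-algebra objects in $\mathcal U$, and let $\mathrm{Comon}(\mathcal V)$ be the category of comonoids in $(\mathcal V,\boxdot,F_{\mathcal V}(\{*\}))$. The free functor $F_{\mathcal U,\mathcal V}\colon\mathcal V\to\mathcal U$ (left adjoint to the forgetful functor $\mathcal U\to\mathcal V$) lifts to a functor $$\widehat F_{\mathcal U,\mathcal V}\colon\mathrm{Comon}(\mathcal V)\to\mathcal U^{c},$$ and this functor is strong monoidal with respect to $\boxdot$ on $\mathrm{Comon}(\mathcal V)$ and the Tall–Wraith product $\odot$ on $\mathcal U^{c}$. Moreover, the free functor $F_{\mathcal V}\colon\mathrm{Set}\to\mathcal V$ factors through $\mathrm{Comon}(\mathcal V)$, and the lift $\widehat F_{\mathcal U}\colon\mathrm{Set}\to\mathcal U^{c}$ of the free $\mathcal U$-algebra functor factors as $\widehat F_{\mathcal U}\cong\widehat F_{\mathcal U,\mathcal V}F_{\mathcal V}$.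
   Context: A variety of algebras is the category of set-models of a (finitary, single-sorted) Lawvere theory. $\mathcal V$ is commutative if every operation is a morphism in $\mathcal V$. Then (Linton) $\mathcal V$ is closed symmetric monoidal: the internal hom is the set of homomorphisms with pointwise operations; $V_1\boxdot V_2$ is the object such that $\mathrm{Hom}_{\mathcal V}(V_1\boxdot V_2,V_3)$ is naturally the set of maps $|V_1|\times|V_2|\to|V_3|$ that are homomorphisms in each variable; the unit is $F_{\mathcal V}(\{*\})$, the free $\mathcal V$-algebra on one element. A $\mathrm{Set}$-based operad is an operad in $(\mathrm{Set},\times)$; a $\mathcal W$-algebra in $\mathcal V$ is an object $V$ with maps $\mathcal W(n)\to\mathrm{Hom}_{\mathcal V}(V^{\boxdot n},V)$ compatible with units, composition and symmetric group actions. These form a variety of algebras $\mathcal U$. A comonoid in $\mathcal V$ is an object $K$ with $\mathcal V$-morphisms $\Delta\colon K\to K\boxdot K$ and $\epsilon\colon K\to F_{\mathcal V}(\{*\})$, with $\Delta$ coassociative and $\epsilon$ a counit for $\Delta$. $\mathrm{Comon}(\mathcal V)$ inherits a symmetric monoidal structure from $\boxdot$. A co-$\mathcal U$-algebra object in $\mathcal U$ is a model of the theory of $\mathcal U$ in $\mathcal U^{op}$; equivalently an object $X$ of $\mathcal U$ with a lift of $\mathrm{Hom}_{\mathcal U}(X,-)$ to a functor $\mathcal U\to\mathcal U$; for $T\in\mathcal U^{c}$ and $U\in\mathcal U$, $\mathrm{Hom}_{\mathcal U}(T,U)$ denotes the resulting $\mathcal U$-algebra. The Tall–Wraith monoidal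 structure $(\mathcal U^{c},\odot,I)$ is characterised by $\mathrm{Hom}_{\mathcal U}(T_1\odot T_2,U)\cong\mathrm{Hom}_{\mathcal U}(T_1,\mathrm{Hom}_{\mathcal U}(T_2,U))$, $\mathrm{Hom}_{\mathcal U}(I,U)\cong U$, naturally as $\mathcal U$-algebras. ''Lifts'' means that $\widehat F_{\mathcal U,\mathcal V}$ followed by the forgetful functor $\mathcal U^{c}\to\mathcal U$ is the forgetful functor $\mathrm{Comon}(\mathcal V)\to\mathcal V$ followed by $F_{\mathcal U,\mathcal V}$. $\widehat F_{\mathcal U}$ sends a set $X$ to the free $\mathcal U$-algebra $F_{\mathcal U}(X)$ on $X$ with the co-$\mathcal U$-structure making $\mathrm{Hom}_{\mathcal U}(F_{\mathcal U}(X),U)\cong\mathrm{Hom}_{\mathrm{Set}}(X,|U|)$ an isomorphism of $\mathcal U$-algebras. $F_{\mathcal V}$ factors through $\mathrm{Comon}(\mathcal V)$ by using the diagonal $X\to X\times X$ and $X\to\{*\}$ together with $F_{\mathcal V}(X\times X)\cong F_{\mathcal V}(X)\boxdot F_{\mathcal V}(X)$.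
   Formalization: The claim fails for symmetric operads with arbitrary comonoids (e.g. commutative rings over abelian groups); it is proved for symmetric operads with Comon(V) restricted to cocommutative comonoids, and for non-symmetric operads with all comonoids. *)

(* Defs.v *)
From mathcomp Require Import all_boot order perm.
From mathcomp Require Import boolp.

Set Implicit Arguments.
Unset Strict Implicit.
Unset Printing Implicit Defensive.

Record category := Category {
  ob :> Type;
  hom : ob -> ob -> Type;
  idm : forall A, hom A A;
  cmp : forall A B C, hom B C -> hom A B -> hom A C;
  cmp1m : forall A B (f : hom A B), cmp (idm B) f = f;
  cmpm1 : forall A B (f : hom A B), cmp f (idm A) = f;
  cmpA : forall A B C D (h : hom C D) (g : hom B C) (f : hom A B),
    cmp h (cmp g f) = cmp (cmp h g) f }.

Arguments hom {_} _ _.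
Arguments idm {_} _.
Arguments cmp {_ _ _ _} _ _.
Notation "g \;o f" := (cmp g f) (at level 50, left associativity).

Definition is_iso (C : category) (A B : C) (f : hom A B) : Prop :=
  exists g : hom B A, g \;o f = idm A /\ f \;o g = idm B.

Record functor (C D : category) := Functor {
  fob :> C -> D;
  fmap : forall A B, hom A B -> hom (fob A) (fob B);
  fmap1 : forall A, fmap (idm A) = idm (fob A);
  fmapM : forall A B E (g : hom B E) (f : hom A B),
    fmap (g \;o f) = fmap g \;o fmap f }.

Arguments fmap {_ _} _ {_ _} _.

Program Definition id_functor (C : category) : functor C C :=
  @Functor C C (fun A => A) (fun _ _ f => f) _ _.

Program Definition comp_functor (C D E : category)
    (G : functor D E) (F : functor C D) : functor C E :=
  @Functor C E (fun A => G (F A)) (fun _ _ f => fmap G (fmap F f)) _ _.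
Next Obligation. by rewrite !fmap1. Qed.
Next Obligation. by rewrite !fmapM. Qed.

Record nat_iso (C D : category) (F G : functor C D) := NatIso {
  ni_app :> forall A, hom (F A) (G A);
  ni_nat : forall A B (f : hom A B), ni_app B \;o fmap F f = fmap G f \;o ni_app A;
  ni_iso : forall A, is_iso (ni_app A) }.

Record universal_arrow (C D : category) (G : functor D C) (X : C) := UniversalArrow {
  ua_ob : D;
  ua_unit : hom X (G ua_ob);
  ua_ext : forall Y : D, hom X (G Y) -> hom ua_ob Y;
  ua_extE : forall (Y : D) (f : hom X (G Y)), fmap G (ua_ext f) \;o ua_unit = f;
  ua_uniq : forall (Y : D) (h k : hom ua_ob Y),
    fmap G h \;o ua_unit = fmap G k \;o ua_unit -> h = k }.

Arguments ua_ext {_ _ _ _} _ {_} _.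

Section LeftAdjoint.
Variables (C D : category) (G : functor D C).
Variable free : forall X : C, universal_arrow G X.

Program Definition left_adjoint : functor C D :=
  @Functor C D (fun X => ua_ob (free X))
    (fun X Y f => ua_ext (free X) (ua_unit (free Y) \;o f)) _ _.
Next Obligation. by apply: ua_uniq; rewrite ua_extE fmap1 cmp1m cmpm1. Qed.
Next Obligation.
apply: ua_uniq; rewrite ua_extE fmapM -(cmpA (fmap G _)) ua_extE.
by rewrite [RHS]cmpA ua_extE cmpA.
Qed.

End LeftAdjoint.

Record monoidal (C : category) := Monoidal {
  tns : C -> C -> C;
  tnsm : forall A A' B B', hom A A' -> hom B B' -> hom (tns A B) (tns A' B');
  tnsm1 : forall A B, tnsm (idm A) (idm B) = idm (tns A B);
  tnsmM : forall A A' A'' B B' B'' (f' : hom A' A'') (f : hom A A')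
                 (g' : hom B' B'') (g : hom B B'),
    tnsm (f' \;o f) (g' \;o g) = tnsm f' g' \;o tnsm f g;
  tunit : C;
  assoc : forall A B E, hom (tns (tns A B) E) (tns A (tns B E));
  lunit : forall A, hom (tns tunit A) A;
  runit : forall A, hom (tns A tunit) A;
  assoc_iso : forall A B E, is_iso (assoc A B E);
  lunit_iso : forall A, is_iso (lunit A);
  runit_iso : forall A, is_iso (runit A);
  assoc_nat : forall A A' B B' E E' (f : hom A A') (g : hom B B') (h : hom E E'),
    assoc A' B' E' \;o tnsm (tnsm f g) h = tnsm f (tnsm g h) \;o assoc A B E;
  lunit_nat : forall A A' (f : hom A A'),
    lunit A' \;o tnsm (idm tunit) f = f \;o lunit A;
  runit_nat : forall A A' (f : hom A A'),
    runit A' \;o tnsm f (idm tunit) = f \;o runit A;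
  pentagon : forall A B E F,
    assoc A B (tns E F) \;o assoc (tns A B) E F =
    tnsm (idm A) (assoc B E F) \;o assoc A (tns B E) F \;o tnsm (assoc A B E) (idm F);
  triangle : forall A B,
    tnsm (idm A) (lunit B) \;o assoc A tunit B = tnsm (runit A) (idm B) }.

Arguments tnsm {_} _ {_ _ _ _} _ _.
Arguments assoc {_} _ _ _ _.
Arguments lunit {_} _ _.
Arguments runit {_} _ _.
Arguments tunit {_} _.

Record symmetry (C : category) (M : monoidal C) := Symmetry {
  swap : forall A B, hom (tns M A B) (tns M B A);
  swap_nat : forall A A' B B' (f : hom A A') (g : hom B B'),
    swap A' B' \;o tnsm M f g = tnsm M g f \;o swap A B;
  swapK : forall A B, swap B A \;o swap A B = idm (tns M A B);
  hexagon : forall A B E,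
    assoc M B E A \;o swap A (tns M B E) \;o assoc M A B E =
    tnsm M (idm B) (swap A E) \;o assoc M B A E \;o tnsm M (swap A B) (idm E) }.

Record strong_monoidal (C D : category) (M : monoidal C) (N : monoidal D)
    (F : functor C D) := StrongMonoidal {
  sm_mul : forall A B, hom (tns N (F A) (F B)) (F (tns M A B));
  sm_unit : hom (tunit N) (F (tunit M));
  sm_mul_nat : forall A A' B B' (f : hom A A') (g : hom B B'),
    sm_mul A' B' \;o tnsm N (fmap F f) (fmap F g) = fmap F (tnsm M f g) \;o sm_mul A B;
  sm_mul_iso : forall A B, is_iso (sm_mul A B);
  sm_unit_iso : is_iso sm_unit;
  sm_assoc : forall A B E,
    fmap F (assoc M A B E) \;o sm_mul (tns M A B) E \;o tnsm N (sm_mul A B) (idm (F E)) =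
    sm_mul A (tns M B E) \;o tnsm N (idm (F A)) (sm_mul B E) \;o assoc N (F A) (F B) (F E);
  sm_lunit : forall A,
    fmap F (lunit M A) \;o sm_mul (tunit M) A \;o tnsm N sm_unit (idm (F A)) =
    lunit N (F A);
  sm_runit : forall A,
    fmap F (runit M A) \;o sm_mul A (tunit M) \;o tnsm N (idm (F A)) sm_unit =
    runit N (F A) }.

Record comonoid_data (C : category) (M : monoidal C) := ComonoidData {
  cm_ob :> C;
  cm_mul : hom cm_ob (tns M cm_ob cm_ob);
  cm_unit : hom cm_ob (tunit M) }.

(* [sym = false]: all comonoids; [sym = true]: the cocommutative ones. The same
   flag selects non-symmetric or symmetric operads below. For an algebra [A]
   over a symmetric operad, compatibility of the convolution operations on
   [Hom(K, A)] with the symmetric group actions needs [K] cocommutative. *)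
Record comonoid (C : category) (M : monoidal C) (S : symmetry M) (sym : bool) := Comonoid {
  cm_data :> comonoid_data M;
  cm_assoc : assoc M _ _ _ \;o tnsm M (cm_mul cm_data) (idm _) \;o cm_mul cm_data =
             tnsm M (idm _) (cm_mul cm_data) \;o cm_mul cm_data;
  cm_lunit : lunit M _ \;o tnsm M (cm_unit cm_data) (idm _) \;o cm_mul cm_data = idm _;
  cm_runit : runit M _ \;o tnsm M (idm _) (cm_unit cm_data) \;o cm_mul cm_data = idm _;
  cm_comm : sym -> swap S _ _ \;o cm_mul cm_data = cm_mul cm_data }.

Section ComonoidCategory.
Variables (C : category) (M : monoidal C) (S : symmetry M) (sym : bool).

Record comonoid_hom (K L : comonoid_data M) := ComonoidHom {
  cmh :> hom K L;
  cmh_mul : cm_mul L \;o cmh = tnsm M cmh cmh \;o cm_mul K;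
  cmh_unit : cm_unit L \;o cmh = cm_unit K }.

Lemma comonoid_hom_ext (K L : comonoid_data M) (f g : comonoid_hom K L) :
  cmh f = cmh g -> f = g.
Proof.
case: f g => [f p q] [g r s] /= e; case: _ / e in r s *.
by congr ComonoidHom; apply: Prop_irrelevance.
Qed.

Program Definition comonoid_id (K : comonoid_data M) : comonoid_hom K K :=
  @ComonoidHom K K (idm _) _ _.
Next Obligation. by rewrite tnsm1 cmp1m cmpm1. Qed.
Next Obligation. by rewrite cmpm1. Qed.

Program Definition comonoid_cmp (K L N : comonoid_data M)
    (g : comonoid_hom L N) (f : comonoid_hom K L) : comonoid_hom K N :=
  @ComonoidHom K N (g \;o f) _ _.
Next Obligation. by rewrite cmpA cmh_mul -cmpA cmh_mul cmpA tnsmM. Qed.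
Next Obligation. by rewrite cmpA !cmh_unit. Qed.

Program Definition Comon : category :=
  @Category (comonoid S sym) (fun K L => comonoid_hom K L)
    (fun K => comonoid_id K) (fun K L N g f => comonoid_cmp g f) _ _ _.
Next Obligation. by apply: comonoid_hom_ext; rewrite /= cmp1m. Qed.
Next Obligation. by apply: comonoid_hom_ext; rewrite /= cmpm1. Qed.
Next Obligation. by apply: comonoid_hom_ext; rewrite /= cmpA. Qed.

Program Definition forget_comon : functor Comon C :=
  @Functor Comon C (fun K => cm_ob K) (fun _ _ f => cmh f) _ _.

Lemma comon_iso (K L : Comon) (f : hom K L) : is_iso (cmh f) -> is_iso f.
Proof.
case=> g [gf fg].
have p : cm_mul K \;o g = tnsm M g g \;o cm_mul L.
  rewrite -[cm_mul L]cmpm1 -fg [cm_mul L \;o _]cmpA cmh_mul !cmpA -tnsmM gf tnsm1.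
  by rewrite cmp1m.
have q : cm_unit K \;o g = cm_unit L by rewrite -(cmh_unit f) -cmpA fg cmpm1.
by exists (ComonoidHom p q); split; apply: comonoid_hom_ext.
Qed.

End ComonoidCategory.

(* The object [n] is the n-fold product of the object [1]; the n-ary
   operations are the morphisms [n -> 1]. *)
Record lawvere_theory := LawvereTheory {
  lt_hom :> nat -> nat -> Type;
  lt_id : forall n, lt_hom n n;
  lt_cmp : forall n m p, lt_hom m p -> lt_hom n m -> lt_hom n p;
  lt_cmp1m : forall n m (f : lt_hom n m), lt_cmp (lt_id m) f = f;
  lt_cmpm1 : forall n m (f : lt_hom n m), lt_cmp f (lt_id n) = f;
  lt_cmpA : forall n m p q (h : lt_hom p q) (g : lt_hom m p) (f : lt_hom n m),
    lt_cmp h (lt_cmp g f) = lt_cmp (lt_cmp h g) f;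
  lt_proj : forall n, 'I_n -> lt_hom n 1;
  lt_proj1 : forall i : 'I_1, lt_proj i = lt_id 1;
  lt_prod : forall n m (f : 'I_m -> lt_hom n 1),
    exists! g : lt_hom n m, forall i, lt_cmp (lt_proj i) g = f i }.

(* A product-preserving functor to sets sending [n] to [Y^n] and the
   projections of the theory to the projections of [Y^n]. *)
Record alg_on (T : lawvere_theory) (Y : Type) := AlgOn {
  interp : forall n m, T n m -> ('I_n -> Y) -> ('I_m -> Y);
  interp_id : forall n (x : 'I_n -> Y), interp (lt_id T n) x = x;
  interp_cmp : forall n m p (g : T m p) (f : T n m) (x : 'I_n -> Y),
    interp (lt_cmp g f) x = interp g (interp f x);
  interp_proj : forall n (i : 'I_n) (x : 'I_n -> Y),
    interp (lt_proj T i) x = fun=> x i }.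

Record alg (T : lawvere_theory) := Alg {
  alg_car :> Type;
  alg_str : alg_on T alg_car }.

Definition aop (T : lawvere_theory) (A : alg T) n m (o : T n m) (x : 'I_n -> A) :
  'I_m -> A := interp (alg_str A) o x.

Definition is_hom (T : lawvere_theory) (A B : alg T) (f : A -> B) : Prop :=
  forall n m (o : T n m) (x : 'I_n -> A) j, f (aop o x j) = aop o (f \o x) j.

Record alg_hom (T : lawvere_theory) (A B : alg T) := AlgHom {
  ah_fun :> A -> B;
  ah_hom : is_hom ah_fun }.

Lemma alg_hom_ext (T : lawvere_theory) (A B : alg T) (f g : alg_hom A B) :
  (forall x, f x = g x) -> f = g.
Proof.
case: f g => [f p] [g q] /= /funext e; case: _ / e in q *.
by congr AlgHom; apply: Prop_irrelevance.
Qed.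

Program Definition alg_id (T : lawvere_theory) (A : alg T) : alg_hom A A :=
  @AlgHom T A A (fun x => x) _.
Next Obligation. by []. Qed.

Program Definition alg_cmp (T : lawvere_theory) (A B C : alg T)
    (g : alg_hom B C) (f : alg_hom A B) : alg_hom A C :=
  @AlgHom T A C (fun x => g (f x)) _.
Next Obligation. by move=> *; rewrite !ah_hom. Qed.

Program Definition alg_pow (T : lawvere_theory) (A : alg T) (X : Type) : alg T :=
  @Alg T (X -> A) (@AlgOn T (X -> A) (fun n m o x j s => aop o (fun i => x i s) j) _ _ _).
Next Obligation.
by apply: funext => j; apply: funext => s; rewrite /aop interp_id.
Qed.
Next Obligation.
by apply: funext => j; apply: funext => s; rewrite /aop interp_cmp.
Qed.
Next Obligation.
by apply: funext => j; apply: funext => s; rewrite /aop interp_proj.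
Qed.

Definition commutative_theory (T : lawvere_theory) : Prop :=
  forall (A : alg T) n (o : T n 1), @is_hom T (alg_pow A 'I_n) A (fun x => aop o x ord0).

Record comm_theory := CommTheory {
  ct_theory :> lawvere_theory;
  ct_comm : commutative_theory ct_theory }.

Program Definition SET : category :=
  @Category Type (fun X Y => X -> Y) (fun _ x => x) (fun _ _ _ g f x => g (f x)) _ _ _.

Program Definition VAlg (T : lawvere_theory) : category :=
  @Category (alg T) (@alg_hom T) (@alg_id T) (@alg_cmp T) _ _ _.
Next Obligation. exact: alg_hom_ext. Qed.
Next Obligation. exact: alg_hom_ext. Qed.
Next Obligation. exact: alg_hom_ext. Qed.

Program Definition forget_V (T : lawvere_theory) : functor (VAlg T) SET :=
  @Functor (VAlg T) SET (@alg_car T) (fun A B (f : alg_hom A B) => ah_fun f) _ _.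

(* The terms over a signature, modulo the identities valid in a given family of
   structures with a valuation of the generators. *)
Section JointQuotient.
Variables (S : Type) (ar : S -> nat) (X I : Type) (A : I -> Type).
Variable str : forall i (s : S), ('I_(ar s) -> A i) -> A i.
Variable rho : forall i, X -> A i.

Inductive term := TVar of X | TApp s of 'I_(ar s) -> term.

Fixpoint teval i (t : term) : A i :=
  match t with
  | TVar x => rho i x
  | TApp s u => str (fun k => teval i (u k))
  end.

Definition teqv (t u : term) : Prop := forall i, teval i t = teval i u.

Record joint_quotient := JointQuotient {
  jq : Type;
  jq_op : forall s, ('I_(ar s) -> jq) -> jq;
  jq_gen : X -> jq;
  jq_pi : forall i, jq -> A i;
  jq_pi_op : forall i s x, jq_pi i (@jq_op s x) = str (fun k => jq_pi i (x k));
  jq_pi_gen : forall i x, jq_pi i (jq_gen x) = rho i x;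
  jq_inj : forall x y, (forall i, jq_pi i x = jq_pi i y) -> x = y;
  jq_ind : forall P : jq -> Prop, (forall x, P (jq_gen x)) ->
    (forall s x, (forall k, P (x k)) -> P (@jq_op s x)) -> forall x, P x }.

Lemma joint_quotientP : joint_quotient.
Proof.
pose Q := {c : term -> Prop | exists t, c = teqv t}.
pose cl (t : term) : Q := exist _ (teqv t) (ex_intro _ t erefl).
pose rep (q : Q) : term := sval (cid (proj2_sig q)).
have repE q : cl (rep q) = q.
  case: q => c e; rewrite /rep /=; case: (cid _) => t /= ct.
  by apply: eq_exist; rewrite /= -ct.
have clE t u : teqv t u -> cl t = cl u.
  by move=> tu; apply: eq_exist; apply: funext => v; apply: propext; split => h i;
     [rewrite -tu|rewrite tu]; exact: h.
have clK i t : teval i (rep (cl t)) = teval i t.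
  have /(congr1 (fun q : Q => proj1_sig q t)) /= e := repE (cl t).
  suff : teqv (rep (cl t)) t by apply.
  by rewrite e.
exists Q (fun s x => cl (@TApp s (fun k => rep (x k)))) (fun x => cl (TVar x))
  (fun i q => teval i (rep q)).
- by move=> i s x; rewrite clK.
- by move=> i x; rewrite clK.
- by move=> x y e; rewrite -(repE x) -(repE y); apply: clE.
move=> P Pg Po q; rewrite -(repE q); elim: (rep q) => [x|s u ih]; first exact: Pg.
rewrite (clE _ (TApp (fun k => rep (cl (u k))))); first exact: Po.
by move=> i /=; congr str; apply: funext => k; rewrite clK.
Qed.

End JointQuotient.

Section GenAlg.
Variable T : lawvere_theory.

Section JointAlg.
Variables (Q I : Type) (A : I -> alg T) (q : forall n m, T n m -> ('I_n -> Q) -> 'I_m -> Q).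
Variable pi : forall i, Q -> A i.
Hypothesis pi_q : forall i n m (o : T n m) x j, pi i (q o x j) = aop o (fun k => pi i (x k)) j.
Hypothesis pi_inj : forall x y, (forall i, pi i x = pi i y) -> x = y.

Lemma pi_qf i n m (o : T n m) x : (fun j => pi i (q o x j)) = aop o (fun k => pi i (x k)).
Proof. by apply: funext => j; apply: pi_q. Qed.

Program Definition joint_alg_on : alg_on T Q := @AlgOn T Q q _ _ _.
Next Obligation.
by apply: funext => j; apply: pi_inj => i; rewrite pi_q /aop interp_id.
Qed.
Next Obligation.
by apply: funext => j; apply: pi_inj => i; rewrite !pi_q pi_qf /aop interp_cmp.
Qed.
Next Obligation.
by apply: funext => j; apply: pi_inj => k; rewrite pi_q /aop interp_proj.
Qed.

End JointAlg.

Variables (X : Type) (P : forall A : alg T, (X -> A) -> Prop).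

Record gen_alg := GenAlg {
  ga :> alg T;
  ga_gen : X -> ga;
  ga_pi : forall (A : alg T) (rho : X -> A), P rho -> alg_hom ga A;
  ga_piE : forall (A : alg T) (rho : X -> A) (p : P rho) x, ga_pi p (ga_gen x) = rho x;
  ga_inj : forall x y,
    (forall (A : alg T) (rho : X -> A) (p : P rho), ga_pi p x = ga_pi p y) -> x = y;
  ga_ext : forall (B : alg T) (f g : alg_hom ga B),
    (forall x, f (ga_gen x) = g (ga_gen x)) -> f = g }.

Lemma gen_algP : gen_alg.
Proof.
pose S := {n : nat & {m : nat & (T n m * 'I_m)%type}}.
pose ar (s : S) := tag s.
pose I := {A : alg T & {rho : X -> A | P rho}}.
pose A (i : I) : Type := tag i.
pose str i (s : S) : ('I_(ar s) -> A i) -> A i :=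
  let: existT n (existT m (o, j)) := s in fun x => aop o x j.
pose rho (i : I) : X -> A i := sval (tagged i).
have J := joint_quotientP str rho.
pose q n m (o : T n m) (x : 'I_n -> jq J) (j : 'I_m) : jq J :=
  @jq_op _ _ _ _ _ _ _ J (existT _ n (existT _ m (o, j))) x.
have pi_q i n m (o : T n m) x j :
    @jq_pi _ _ _ _ _ _ _ J i (q n m o x j) = @aop T (tag i) _ _ o (fun k => jq_pi i (x k)) j.
  by rewrite jq_pi_op.
pose QA : alg T := Alg (joint_alg_on pi_q (@jq_inj _ _ _ _ _ _ _ J)).
pose pi (B : alg T) (r : X -> B) (p : P r) : alg_hom QA B :=
  @AlgHom T QA B (@jq_pi _ _ _ _ _ _ _ J (existT _ B (exist _ r p)))
    (fun n m o x j => pi_q (existT _ B (exist _ r p)) n m o x j).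
exists QA (@jq_gen _ _ _ _ _ _ _ J) pi.
- by move=> B r p x; rewrite /= jq_pi_gen.
- by move=> x y e; apply: (@jq_inj _ _ _ _ _ _ _ J) => -[B [r p]]; apply: (e B r p).
move=> B f g e; apply: alg_hom_ext; apply: (@jq_ind _ _ _ _ _ _ _ J) => // s x ih.
case: s x ih => n [m [o j]] x ih; rewrite -/(q n m o x j).
rewrite -[q n m o x j]/(@aop T QA _ _ o x j) !ah_hom.
by congr aop; apply: funext => k; apply: ih.
Qed.

End GenAlg.

Lemma free_V (T : lawvere_theory) (X : SET) : universal_arrow (forget_V T) X.
Proof.
have G := @gen_algP T X (fun _ _ => True).
exists (ga G : VAlg T) (@ga_gen _ _ _ G) (fun (Y : VAlg T) f => @ga_pi _ _ _ G Y f I).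
- by move=> Y f; apply: funext => x; rewrite /= ga_piE.
- by move=> Y h k e; apply: ga_ext => x; have := congr1 (fun f => f x) e.
Qed.

Definition FV (T : lawvere_theory) : functor SET (VAlg T) := left_adjoint (@free_V T).

Definition eta_V (T : lawvere_theory) (X : Type) : X -> FV T X := ua_unit (@free_V T X).

Definition bihom (T : lawvere_theory) (A B C : alg T) (f : A -> B -> C) : Prop :=
  (forall b, is_hom (fun a => f a b)) /\ (forall a, is_hom (f a)).

Record tensor_product (T : lawvere_theory) (A B : alg T) := TensorProduct {
  tp_ob : alg T;
  tp_pure : A -> B -> tp_ob;
  tp_bihom : bihom tp_pure;
  tp_ext : forall (C : alg T) (f : A -> B -> C), bihom f -> alg_hom tp_ob C;
  tp_extE : forall (C : alg T) (f : A -> B -> C) (p : bihom f) a b,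
    tp_ext p (tp_pure a b) = f a b;
  tp_uniq : forall (C : alg T) (h k : alg_hom tp_ob C),
    (forall a b, h (tp_pure a b) = k (tp_pure a b)) -> h = k }.

Lemma tensorP (T : lawvere_theory) (A B : alg T) : tensor_product A B.
Proof.
have G := @gen_algP T (A * B)%type (fun C f => bihom (fun a b => f (a, b))).
have GE (C : alg T) (r : A * B -> C) (p : bihom (fun a b => r (a, b))) x :
  @ga_pi _ _ _ G C r p (ga_gen G x) = r x.
  exact: (@ga_piE _ _ _ G C r p x).
exists (ga G) (fun a b => ga_gen G (a, b))
  (fun C f p => @ga_pi _ _ _ G C (fun x => f x.1 x.2) p).
- split=> [b n m o x j|a n m o x j]; apply: ga_inj => C r p; rewrite GE ah_hom.
  + by rewrite (proj1 p); congr aop; apply: funext => k /=; rewrite GE.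
  + by rewrite (proj2 p); congr aop; apply: funext => k /=; rewrite GE.
- by move=> C f p a b; rewrite GE.
- by move=> C h k e; apply: ga_ext => -[a b].
Qed.

Definition ten (T : lawvere_theory) (A B : alg T) : alg T := tp_ob (tensorP A B).
Definition pure (T : lawvere_theory) (A B : alg T) (a : A) (b : B) : ten A B :=
  tp_pure (tensorP A B) a b.

Definition tenunit (T : lawvere_theory) : alg T := FV T unit.

#[local] Obligation Tactic := idtac.

Section MonoidalV.
Variable T : comm_theory.
Implicit Types A B C D E F : alg T.

Lemma aop_cmp_proj A n m (o : T n m) (x : 'I_n -> A) j :
  aop o x j = aop (lt_cmp (lt_proj T j) o) x ord0.
Proof. by rewrite /aop interp_cmp interp_proj. Qed.

Lemma aop_comm A n m (o : T n m) p q (o' : T p q) (z : 'I_n -> 'I_p -> A) j j' :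
  aop o (fun k => aop o' (z k) j') j = aop o' (fun l => aop o (fun k => z k l) j) j'.
Proof.
rewrite aop_cmp_proj (ct_comm (lt_cmp (lt_proj T j) o) o' (fun l k => z k l) j').
by congr aop; apply: funext => l /=; rewrite -aop_cmp_proj.
Qed.

Program Definition ihom_op A B n m (o : T n m) (h : 'I_n -> alg_hom A B) (j : 'I_m) :
  alg_hom A B := @AlgHom T A B (fun a => aop o (fun k => h k a) j) _.
Next Obligation.
move=> A B n m o h j p q o' x j' /=; rewrite -aop_comm.
by congr aop; apply: funext => k; rewrite ah_hom.
Qed.

Definition ihom A B : alg T :=
  @Alg T (alg_hom A B)
    (@joint_alg_on T (alg_hom A B) A (fun=> B) (@ihom_op A B) (fun a h => ah_fun h a)
       (fun _ _ _ _ _ _ => erefl) (@alg_hom_ext T A B)).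

Lemma ihom_opE A B n m (o : T n m) (h : 'I_n -> ihom A B) j a :
  (aop o h j : ihom A B) a = aop o (fun k => (h k : ihom A B) a) j.
Proof. by []. Qed.

Lemma pure_homl A B (b : B) : is_hom (fun a : A => pure a b).
Proof. exact: (proj1 (tp_bihom (tensorP A B)) b). Qed.

Lemma pure_homr A B (a : A) : is_hom (fun b : B => pure a b).
Proof. exact: (proj2 (tp_bihom (tensorP A B)) a). Qed.

Definition purel A B (b : B) : alg_hom A (ten A B) := AlgHom (@pure_homl A B b).
Definition purer A B (a : A) : alg_hom B (ten A B) := AlgHom (@pure_homr A B a).

Lemma bihomP A B C (f : A -> B -> C) : bihom f ->
  exists h : alg_hom (ten A B) C, forall a b, h (pure a b) = f a b.
Proof. by move=> p; exists (tp_ext (tensorP A B) p) => a b; rewrite tp_extE. Qed.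

Lemma ten_ext A B C (h k : alg_hom (ten A B) C) :
  (forall a b, h (pure a b) = k (pure a b)) -> h = k.
Proof. exact: tp_uniq. Qed.

Lemma ten_extx A B C (h k : alg_hom (ten A B) C) :
  (forall a b, h (pure a b) = k (pure a b)) -> forall x, h x = k x.
Proof. by move/ten_ext ->. Qed.

Lemma eta_ext X A (h k : alg_hom (FV T X) A) :
  (forall x, h (eta_V T x) = k (eta_V T x)) -> h = k.
Proof. by move=> e; apply: (ua_uniq (u := @free_V T X)); apply: funext. Qed.

Lemma eta_ex X A (f : X -> A) : exists h : alg_hom (FV T X) A, forall x, h (eta_V T x) = f x.
Proof.
exists (ua_ext (@free_V T X) (Y := A : VAlg T) f) => x.
exact: (congr1 (fun g => g x) (@ua_extE _ _ _ _ (@free_V T X) A f)).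
Qed.

Lemma eta_extu A (h k : alg_hom (tenunit T) A) :
  h (eta_V T tt) = k (eta_V T tt) -> h = k.
Proof. by move=> e; apply: eta_ext => -[]. Qed.

Lemma uncurryP A B C (f : alg_hom A (ihom B C)) :
  exists h : alg_hom (ten A B) C, forall a b, h (pure a b) = (f a : ihom B C) b.
Proof.
apply: bihomP; split=> [b|a] n m o x j; last exact: ah_hom.
by rewrite ah_hom ihom_opE.
Qed.

Lemma trihomP A B C D (f : A -> B -> C -> D) :
  (forall b c, is_hom (fun a => f a b c)) -> (forall a c, is_hom (fun b => f a b c)) ->
  (forall a b, is_hom (f a b)) ->
  exists h : alg_hom (ten (ten A B) C) D, forall a b c, h (pure (pure a b) c) = f a b c.
Proof.
move=> p q r; have [|h hE] := @bihomP A B (ihom C D) (fun a b => AlgHom (r a b)).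
  split=> [b|a] n m o x j; apply: alg_hom_ext => c /=; [exact: p|exact: q].
by have [k kE] := uncurryP h; exists k => a b c; rewrite kE hE.
Qed.

Lemma trihomP' A B C D (f : A -> B -> C -> D) :
  (forall b c, is_hom (fun a => f a b c)) -> (forall a c, is_hom (fun b => f a b c)) ->
  (forall a b, is_hom (f a b)) ->
  exists h : alg_hom (ten A (ten B C)) D, forall a b c, h (pure a (pure b c)) = f a b c.
Proof.
move=> p q r.
have /choice[g gE] a : exists h : alg_hom (ten B C) D, forall b c, h (pure b c) = f a b c.
  by apply: bihomP; split=> [c|b]; [exact: q|exact: r].
have gh : @is_hom T A (ihom (ten B C) D) g.
  move=> n m o x j; apply: ten_ext => b c; rewrite gE p ihom_opE.
  by congr aop; apply: funext => k /=; rewrite gE.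
by have [k kE] := uncurryP (AlgHom gh); exists k => a b c; rewrite kE gE.
Qed.

Lemma quadrihomP A B C D E (f : A -> B -> C -> D -> E) :
  (forall b c d, is_hom (fun a => f a b c d)) ->
  (forall a c d, is_hom (fun b => f a b c d)) ->
  (forall a b d, is_hom (fun c => f a b c d)) ->
  (forall a b c, is_hom (f a b c)) ->
  exists h : alg_hom (ten (ten A B) (ten C D)) E,
    forall a b c d, h (pure (pure a b) (pure c d)) = f a b c d.
Proof.
move=> p q r s.
have /choice[g gE] (ab : A * B) : exists h : alg_hom (ten C D) E,
    forall c d, h (pure c d) = f ab.1 ab.2 c d.
  by apply: bihomP; split=> [d|c]; [exact: r|exact: s].
have [|||h hE] := @trihomP A B (ten C D) E (fun a b => g (a, b)).
- move=> b x n m o y j.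
  suff -> : g (aop o y j, b) = aop o (fun k => g (y k, b) : ihom (ten C D) E) j by [].
  apply: ten_ext => c d; rewrite gE ihom_opE [LHS]p.
  by congr aop; apply: funext => k /=; rewrite gE.
- move=> a x n m o y j.
  suff -> : g (a, aop o y j) = aop o (fun k => g (a, y k) : ihom (ten C D) E) j by [].
  apply: ten_ext => c d; rewrite gE ihom_opE [LHS]q.
  by congr aop; apply: funext => k /=; rewrite gE.
- by move=> a b; apply: ah_hom.
by exists h => a b c d; rewrite hE gE.
Qed.

Lemma ten3l_ext A B C D (h k : alg_hom (ten (ten A B) C) D) :
  (forall a b c, h (pure (pure a b) c) = k (pure (pure a b) c)) -> h = k.
Proof.
move=> e; apply: ten_ext => x c.
apply: (ten_extx (h := alg_cmp h (purel _ c)) (k := alg_cmp k (purel _ c))) => a b.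
exact: e.
Qed.

Lemma ten3r_ext A B C D (h k : alg_hom (ten A (ten B C)) D) :
  (forall a b c, h (pure a (pure b c)) = k (pure a (pure b c))) -> h = k.
Proof.
move=> e; apply: ten_ext => a x.
apply: (ten_extx (h := alg_cmp h (purer _ a)) (k := alg_cmp k (purer _ a))) => b c.
exact: e.
Qed.

Lemma ten4_ext A B C D E (h k : alg_hom (ten (ten A B) (ten C D)) E) :
  (forall a b c d, h (pure (pure a b) (pure c d)) = k (pure (pure a b) (pure c d))) -> h = k.
Proof.
move=> e; apply: ten3l_ext => a b x.
apply: (ten_extx (h := alg_cmp h (purer _ (pure a b)))
                 (k := alg_cmp k (purer _ (pure a b)))) => c d.
exact: e.
Qed.

Lemma ten4l_ext A B C D E (h k : alg_hom (ten (ten (ten A B) C) D) E) :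
  (forall a b c d, h (pure (pure (pure a b) c) d) = k (pure (pure (pure a b) c) d)) -> h = k.
Proof.
move=> e; apply: ten_ext => x d.
suff /(congr1 (fun f : alg_hom _ _ => f x)) :
  alg_cmp h (purel _ d) = alg_cmp k (purel _ d) by [].
by apply: ten3l_ext => a b c; exact: e.
Qed.

Lemma ten6_ext A B C D E E' F (h k : alg_hom (ten (ten (ten A B) (ten C D)) (ten E E')) F) :
  (forall a b c d e e', h (pure (pure (pure a b) (pure c d)) (pure e e')) =
                        k (pure (pure (pure a b) (pure c d)) (pure e e'))) -> h = k.
Proof.
move=> H; apply: ten_ext => x y.
apply: (ten_extx (h := alg_cmp h (purer _ x)) (k := alg_cmp k (purer _ x))) => e e'.
suff /(congr1 (fun f : alg_hom _ _ => f x)) :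
  alg_cmp h (purel _ (pure e e')) = alg_cmp k (purel _ (pure e e')) by [].
by apply: ten4_ext => a b c d; exact: H.
Qed.

Lemma tenmP A A' B B' (f : alg_hom A A') (g : alg_hom B B') :
  exists h : alg_hom (ten A B) (ten A' B'), forall a b, h (pure a b) = pure (f a) (g b).
Proof.
apply: bihomP; split=> [b|a] n m o x j.
- by rewrite ah_hom pure_homl.
- by rewrite ah_hom pure_homr.
Qed.

Definition tenm A A' B B' (f : alg_hom A A') (g : alg_hom B B') :
  alg_hom (ten A B) (ten A' B') := sval (cid (tenmP f g)).

Lemma tenmE A A' B B' (f : alg_hom A A') (g : alg_hom B B') a b :
  tenm f g (pure a b) = pure (f a) (g b).
Proof. exact: (svalP (cid (tenmP f g))). Qed.

Lemma ten_assocP A B C : exists h : alg_hom (ten (ten A B) C) (ten A (ten B C)),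
  forall a b c, h (pure (pure a b) c) = pure a (pure b c).
Proof.
apply: trihomP=> [b c|a c|a b] n m o x j; rewrite ?pure_homl ?pure_homr //.
Qed.

Lemma ten_assoc'P A B C : exists h : alg_hom (ten A (ten B C)) (ten (ten A B) C),
  forall a b c, h (pure a (pure b c)) = pure (pure a b) c.
Proof.
apply: trihomP'=> [b c|a c|a b] n m o x j; rewrite ?pure_homl ?pure_homr //.
by rewrite pure_homl.
Qed.

Definition ten_assoc A B C : alg_hom (ten (ten A B) C) (ten A (ten B C)) :=
  sval (cid (ten_assocP A B C)).

Lemma ten_assocE A B C (a : A) (b : B) (c : C) :
  ten_assoc A B C (pure (pure a b) c) = pure a (pure b c).
Proof. exact: (svalP (cid (ten_assocP A B C))). Qed.

Lemma ten_lunitP A : exists h : alg_hom (ten (tenunit T) A) A,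
  forall a, h (pure (eta_V T tt) a) = a.
Proof.
have [f fE] := @eta_ex unit (ihom A A) (fun=> alg_id A).
by have [h hE] := uncurryP f; exists h => a; rewrite hE fE.
Qed.

Lemma ten_runitP A : exists h : alg_hom (ten A (tenunit T)) A,
  forall a, h (pure a (eta_V T tt)) = a.
Proof.
have /choice[f fE] a := @eta_ex unit A (fun=> a).
have fh : @is_hom T A (ihom (tenunit T) A) f.
  move=> n m o x j; apply: eta_extu; rewrite fE ihom_opE.
  by congr aop; apply: funext => k /=; rewrite fE.
by have [h hE] := uncurryP (AlgHom fh); exists h => a; rewrite hE fE.
Qed.

Definition ten_lunit A : alg_hom (ten (tenunit T) A) A := sval (cid (ten_lunitP A)).
Definition ten_runit A : alg_hom (ten A (tenunit T)) A := sval (cid (ten_runitP A)).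

Lemma ten_lunitE A (a : A) : ten_lunit A (pure (eta_V T tt) a) = a.
Proof. exact: (svalP (cid (ten_lunitP A))). Qed.

Lemma ten_runitE A (a : A) : ten_runit A (pure a (eta_V T tt)) = a.
Proof. exact: (svalP (cid (ten_runitP A))). Qed.

Lemma tenl_ext A C (h k : alg_hom (ten (tenunit T) A) C) :
  (forall a, h (pure (eta_V T tt) a) = k (pure (eta_V T tt) a)) -> h = k.
Proof.
move=> e; apply: ten_ext => u a.
suff /(congr1 (fun f : alg_hom _ _ => f u)) :
  alg_cmp h (purel _ a) = alg_cmp k (purel _ a) by [].
exact/eta_extu/e.
Qed.

Lemma tenr_ext A C (h k : alg_hom (ten A (tenunit T)) C) :
  (forall a, h (pure a (eta_V T tt)) = k (pure a (eta_V T tt))) -> h = k.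
Proof.
move=> e; apply: ten_ext => a u.
suff /(congr1 (fun f : alg_hom _ _ => f u)) :
  alg_cmp h (purer _ a) = alg_cmp k (purer _ a) by [].
exact/eta_extu/e.
Qed.

Program Definition MV : monoidal (VAlg T) :=
  @Monoidal (VAlg T) (@ten T) tenm _ _ (tenunit T) ten_assoc ten_lunit ten_runit
    _ _ _ _ _ _ _ _.
Next Obligation. by move=> A B; apply: ten_ext => a b; rewrite tenmE. Qed.
Next Obligation. by move=> *; apply: ten_ext => a b /=; rewrite !tenmE. Qed.
Next Obligation.
move=> A B C; have [h hE] := ten_assoc'P A B C; exists h; split.
- by apply: ten3l_ext => a b c; rewrite /= ten_assocE hE.
- by apply: ten3r_ext => a b c; rewrite /= hE ten_assocE.
Qed.
Next Obligation.
move=> A; exists (purer _ (eta_V T tt)); split.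
- by apply: tenl_ext => a; rewrite /= ten_lunitE.
- by apply: alg_hom_ext => a; rewrite /= ten_lunitE.
Qed.
Next Obligation.
move=> A; exists (purel _ (eta_V T tt)); split.
- by apply: tenr_ext => a; rewrite /= ten_runitE.
- by apply: alg_hom_ext => a; rewrite /= ten_runitE.
Qed.
Next Obligation.
by move=> *; apply: ten3l_ext => a b c; rewrite /= !(tenmE, ten_assocE).
Qed.
Next Obligation. by move=> *; apply: tenl_ext => a; rewrite /= !(tenmE, ten_lunitE). Qed.
Next Obligation. by move=> *; apply: tenr_ext => a; rewrite /= !(tenmE, ten_runitE). Qed.
Next Obligation.
by move=> *; apply: ten4l_ext => a b c d; rewrite /= !(tenmE, ten_assocE).
Qed.
Next Obligation.
move=> A B; apply: ten_ext => x b.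
suff /(congr1 (fun f : alg_hom _ _ => f x)) :
  alg_cmp (alg_cmp (tenm (alg_id A) (ten_lunit B)) (ten_assoc A (tenunit T) B)) (purel _ b) =
  alg_cmp (tenm (ten_runit A) (alg_id B)) (purel _ b) by [].
by apply: tenr_ext => a; rewrite /= !(tenmE, ten_assocE, ten_lunitE, ten_runitE).
Qed.

Lemma ten_swapP A B : exists h : alg_hom (ten A B) (ten B A),
  forall a b, h (pure a b) = pure b a.
Proof. by apply: bihomP; split=> [b|a] n m o x j; rewrite ?pure_homl ?pure_homr. Qed.

Definition ten_swap A B : alg_hom (ten A B) (ten B A) := sval (cid (ten_swapP A B)).

Lemma ten_swapE A B (a : A) (b : B) : ten_swap A B (pure a b) = pure b a.
Proof. exact: (svalP (cid (ten_swapP A B))). Qed.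

Program Definition SV : symmetry MV := @Symmetry (VAlg T) MV ten_swap _ _ _.
Next Obligation. by move=> *; apply: ten_ext => a b; rewrite /= !(tenmE, ten_swapE). Qed.
Next Obligation. by move=> *; apply: ten_ext => a b; rewrite /= !ten_swapE. Qed.
Next Obligation.
by move=> *; apply: ten3l_ext => a b c;
   do 4 rewrite /= ?(tenmE, ten_assocE, ten_swapE).
Qed.

Variable sym : bool.

Lemma ten_midP A B C D : exists h : alg_hom (ten (ten A B) (ten C D)) (ten (ten A C) (ten B D)),
  forall a b c d, h (pure (pure a b) (pure c d)) = pure (pure a c) (pure b d).
Proof.
apply: quadrihomP=> [b c d|a c d|a b d|a b c] n m o x j;
  by rewrite ?pure_homl ?pure_homr ?pure_homl ?pure_homr.
Qed.

(* The middle-four interchange, [(a (x) b) (x) (c (x) d) |-> (a (x) c) (x) (b (x) d)]. *)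
Definition ten_mid A B C D : alg_hom (ten (ten A B) (ten C D)) (ten (ten A C) (ten B D)) :=
  sval (cid (ten_midP A B C D)).

Lemma ten_midE A B C D (a : A) (b : B) (c : C) (d : D) :
  ten_mid A B C D (pure (pure a b) (pure c d)) = pure (pure a c) (pure b d).
Proof. exact: (svalP (cid (ten_midP A B C D))). Qed.

#[local] Ltac tens :=
  repeat (progress (rewrite /= ?(tenmE, ten_midE, ten_assocE, ten_lunitE, ten_runitE))).

Definition comon_ten_data (K L : comonoid_data MV) : comonoid_data MV :=
  @ComonoidData _ MV (ten (cm_ob K) (cm_ob L))
    (alg_cmp (ten_mid (cm_ob K) (cm_ob K) (cm_ob L) (cm_ob L)) (tenm (cm_mul K) (cm_mul L)))
    (alg_cmp (ten_lunit (tenunit T)) (tenm (cm_unit K) (cm_unit L))).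

Lemma tenuu_ext C (h k : alg_hom (ten (tenunit T) (tenunit T)) C) :
  h (pure (eta_V T tt) (eta_V T tt)) = k (pure (eta_V T tt) (eta_V T tt)) -> h = k.
Proof.
move=> e; apply: tenl_ext => u.
suff /(congr1 (fun f : alg_hom _ _ => f u)) :
  alg_cmp h (purer _ (eta_V T tt)) = alg_cmp k (purer _ (eta_V T tt)) by [].
exact: eta_extu.
Qed.

Section ComonTen.
Variables K L : comonoid_data MV.
Notation K0 := (cm_ob K : alg T).
Notation L0 := (cm_ob L : alg T).
Let dK : alg_hom K0 (ten K0 K0) := cm_mul K.
Let dL : alg_hom L0 (ten L0 L0) := cm_mul L.
Let eK : alg_hom K0 (tenunit T) := cm_unit K.
Let eL : alg_hom L0 (tenunit T) := cm_unit L.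
Let dKL : alg_hom (ten K0 L0) (ten (ten K0 L0) (ten K0 L0)) := cm_mul (comon_ten_data K L).
Let eKL : alg_hom (ten K0 L0) (tenunit T) := cm_unit (comon_ten_data K L).
Let mid3 := alg_cmp (tenm (alg_id _) (ten_mid K0 K0 L0 L0)) (ten_mid K0 (ten K0 K0) L0 (ten L0 L0)).

Lemma dKLE k l : dKL (pure k l) = ten_mid _ _ _ _ (pure (dK k) (dL l)).
Proof. by rewrite /dKL /= tenmE. Qed.

Lemma eKLE k l : eKL (pure k l) = ten_lunit _ (pure (eK k) (eL l)).
Proof. by rewrite /eKL /= tenmE. Qed.

Lemma comon_ten_coassoc_l :
  alg_cmp (ten_assoc _ _ _) (alg_cmp (tenm dKL (alg_id _)) (ten_mid K0 K0 L0 L0)) =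
  alg_cmp mid3 (tenm (alg_cmp (ten_assoc _ _ _) (tenm dK (alg_id _)))
                     (alg_cmp (ten_assoc _ _ _) (tenm dL (alg_id _)))).
Proof.
apply: ten4_ext => k k' l l'; rewrite /= !(tenmE, ten_midE, dKLE) /= !tenmE.
suff /(congr1 (fun f : alg_hom _ _ => f (pure (dK k) (dL l)))) :
  alg_cmp (ten_assoc _ _ _) (alg_cmp (purel _ (pure k' l')) (ten_mid K0 K0 L0 L0)) =
  alg_cmp mid3 (tenm (alg_cmp (ten_assoc _ _ _) (purel _ k'))
                     (alg_cmp (ten_assoc _ _ _) (purel _ l'))).
  by rewrite /= !tenmE.
by apply: ten4_ext => p q r s; tens.
Qed.

Lemma comon_ten_coassoc_r :
  alg_cmp (tenm (alg_id _) dKL) (ten_mid K0 K0 L0 L0) =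
  alg_cmp mid3 (tenm (tenm (alg_id _) dK) (tenm (alg_id _) dL)).
Proof. by apply: ten4_ext => k k' l l'; rewrite /= !(tenmE, ten_midE, dKLE). Qed.

Lemma comon_ten_lunit :
  alg_cmp (ten_lunit _) (alg_cmp (tenm eKL (alg_id _)) (ten_mid K0 K0 L0 L0)) =
  tenm (alg_cmp (ten_lunit _) (tenm eK (alg_id _))) (alg_cmp (ten_lunit _) (tenm eL (alg_id _))).
Proof.
apply: ten4_ext => k k' l l'; rewrite /= !(tenmE, ten_midE, eKLE) /= !tenmE.
suff /(congr1 (fun f : alg_hom _ _ => f (pure (eK k) (eL l)))) :
  alg_cmp (ten_lunit _) (alg_cmp (purel _ (pure k' l')) (ten_lunit _)) =
  tenm (alg_cmp (ten_lunit _) (purel _ k')) (alg_cmp (ten_lunit _) (purel _ l')).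
  by rewrite /= tenmE.
by apply: tenuu_ext; tens.
Qed.

Lemma comon_ten_runit :
  alg_cmp (ten_runit _) (alg_cmp (tenm (alg_id _) eKL) (ten_mid K0 K0 L0 L0)) =
  tenm (alg_cmp (ten_runit _) (tenm (alg_id _) eK)) (alg_cmp (ten_runit _) (tenm (alg_id _) eL)).
Proof.
apply: ten4_ext => k k' l l'; rewrite /= !(tenmE, ten_midE, eKLE) /= !tenmE.
suff /(congr1 (fun f : alg_hom _ _ => f (pure (eK k') (eL l')))) :
  alg_cmp (ten_runit _) (alg_cmp (purer _ (pure k l)) (ten_lunit _)) =
  tenm (alg_cmp (ten_runit _) (purer _ k)) (alg_cmp (ten_runit _) (purer _ l)).
  by rewrite /= tenmE.
by apply: tenuu_ext; tens.
Qed.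

End ComonTen.

Definition alg_hom_app A B (f g : alg_hom A B) (e : f = g) x : f x = g x :=
  congr1 (fun h : alg_hom A B => h x) e.

Program Definition comon_ten (K L : Comon SV sym) : Comon SV sym :=
  @Comonoid _ MV SV sym (comon_ten_data (cm_data K) (cm_data L)) _ _ _ _.
Next Obligation.
move=> K L; apply: ten_ext => k l; rewrite /= tenmE.
have /= -> := alg_hom_app (comon_ten_coassoc_l K L) (pure (cm_mul K k) (cm_mul L l)).
have /= -> := alg_hom_app (comon_ten_coassoc_r K L) (pure (cm_mul K k) (cm_mul L l)).
rewrite !tenmE /=.
have /= -> := alg_hom_app (cm_assoc K) k.
by have /= -> := alg_hom_app (cm_assoc L) l.
Qed.
Next Obligation.
move=> K L; apply: ten_ext => k l; rewrite /= tenmE.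
have /= -> := alg_hom_app (comon_ten_lunit K L) (pure (cm_mul K k) (cm_mul L l)).
rewrite !tenmE /=.
have /= -> := alg_hom_app (cm_lunit K) k.
by have /= -> := alg_hom_app (cm_lunit L) l.
Qed.
Next Obligation.
move=> K L; apply: ten_ext => k l; rewrite /= tenmE.
have /= -> := alg_hom_app (comon_ten_runit K L) (pure (cm_mul K k) (cm_mul L l)).
rewrite !tenmE /=.
have /= -> := alg_hom_app (cm_runit K) k.
by have /= -> := alg_hom_app (cm_runit L) l.
Qed.
Next Obligation.
move=> K L s; apply: ten_ext => k l; rewrite /= tenmE.
suff E : alg_cmp (ten_swap _ _) (ten_mid _ _ _ _) =
  alg_cmp (ten_mid _ _ _ _)
    (tenm (ten_swap (cm_ob K) (cm_ob K)) (ten_swap (cm_ob L) (cm_ob L))).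
  have /= -> := alg_hom_app E (pure (cm_mul K k) (cm_mul L l)).
  rewrite tenmE; have /= -> := alg_hom_app (cm_comm K s) k.
  by have /= -> := alg_hom_app (cm_comm L s) l.
by apply: ten4_ext => p q r u; rewrite /= !(tenmE, ten_midE, ten_swapE).
Qed.

Program Definition comon_unit : Comon SV sym :=
  @Comonoid _ MV SV sym (@ComonoidData _ MV (tenunit T) (purer _ (eta_V T tt)) (alg_id _)) _ _ _ _.
Next Obligation. by apply: eta_extu; rewrite /= !tenmE /= ten_assocE. Qed.
Next Obligation. by apply: eta_extu; rewrite /= !tenmE /= ten_lunitE. Qed.
Next Obligation. by apply: eta_extu; rewrite /= !tenmE /= ten_runitE. Qed.
Next Obligation. by move=> _; apply: eta_extu; rewrite /= ten_swapE. Qed.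

Program Definition comon_tenm (K K' L L' : Comon SV sym) (f : hom K K') (g : hom L L') :
  hom (comon_ten K L) (comon_ten K' L') :=
  @ComonoidHom _ MV (comon_ten K L) (comon_ten K' L') (tenm (cmh f) (cmh g)) _ _.
Next Obligation.
move=> K K' L L' f g; apply: ten_ext => k l; rewrite /= !tenmE.
have /= -> := alg_hom_app (cmh_mul f) k; have /= -> := alg_hom_app (cmh_mul g) l.
suff E : alg_cmp (ten_mid _ _ _ _) (tenm (tenm (cmh f) (cmh f)) (tenm (cmh g) (cmh g))) =
  alg_cmp (tenm (tenm (cmh f) (cmh g)) (tenm (cmh f) (cmh g))) (ten_mid _ _ _ _).
  by have := alg_hom_app E (pure (cm_mul K k) (cm_mul L l)); rewrite /= tenmE.
by apply: ten4_ext => p q r s; tens.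
Qed.
Next Obligation.
move=> K K' L L' f g; apply: ten_ext => k l; rewrite /= !tenmE.
by have /= -> := alg_hom_app (cmh_unit f) k; have /= -> := alg_hom_app (cmh_unit g) l.
Qed.

Program Definition comon_assoc (K L N : Comon SV sym) :
  hom (comon_ten (comon_ten K L) N) (comon_ten K (comon_ten L N)) :=
  @ComonoidHom _ MV (comon_ten (comon_ten K L) N) (comon_ten K (comon_ten L N))
    (ten_assoc _ _ _) _ _.
Next Obligation.
move=> K L N; apply: ten3l_ext => k l n; rewrite /= !(tenmE, ten_assocE) /= tenmE.
suff E : alg_cmp (alg_cmp (ten_mid _ _ _ _) (tenm (alg_id _) (ten_mid _ _ _ _)))
    (ten_assoc _ _ _) =
  alg_cmp (tenm (ten_assoc (cm_ob K) (cm_ob L) (cm_ob N)) (ten_assoc _ _ _))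
    (alg_cmp (ten_mid _ _ _ _) (tenm (ten_mid _ _ _ _) (alg_id _))).
  by have := alg_hom_app (E _ _ _) (pure (pure (cm_mul K k) (cm_mul L l)) (cm_mul N n));
     rewrite /= !(ten_assocE, tenmE).
by move=> K' L' N'; apply: ten6_ext => a b c d r s; do 3 tens.
Qed.
Next Obligation.
move=> K L N; apply: ten3l_ext => k l n; rewrite /= !(tenmE, ten_assocE) /= tenmE.
suff E : alg_cmp (ten_lunit _) (alg_cmp (tenm (alg_id _) (ten_lunit _)) (ten_assoc _ _ _)) =
    alg_cmp (ten_lunit (tenunit T)) (tenm (ten_lunit (tenunit T)) (alg_id (tenunit T))).
  by have := alg_hom_app E (pure (pure (cm_unit K k) (cm_unit L l)) (cm_unit N n));
     rewrite /= !(ten_assocE, tenmE).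
apply: ten_ext => x u.
suff /alg_hom_app /(_ x) : alg_cmp (alg_cmp (ten_lunit _) (alg_cmp (tenm (alg_id _) (ten_lunit _)) (ten_assoc _ _ _))) (purel _ u) =
    alg_cmp (alg_cmp (ten_lunit (tenunit T)) (tenm (ten_lunit (tenunit T)) (alg_id (tenunit T)))) (purel _ u) by [].
by apply: tenuu_ext; tens.
Qed.

Program Definition comon_lunit (K : Comon SV sym) : hom (comon_ten comon_unit K) K :=
  @ComonoidHom _ MV (comon_ten comon_unit K) K (ten_lunit _) _ _.
Next Obligation.
move=> K; apply: tenl_ext => k; rewrite /= tenmE ten_lunitE.
suff E : alg_cmp (tenm (ten_lunit (cm_ob K)) (ten_lunit _))
    (alg_cmp (ten_mid _ _ _ _) (purer _ (pure (eta_V T tt) (eta_V T tt)))) = alg_id _.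
  by have /= -> := alg_hom_app (E _) (cm_mul K k).
by move=> A; apply: ten_ext => p q; tens.
Qed.
Next Obligation. by move=> K; apply: tenl_ext => k; rewrite /= tenmE !ten_lunitE. Qed.

Program Definition comon_runit (K : Comon SV sym) : hom (comon_ten K comon_unit) K :=
  @ComonoidHom _ MV (comon_ten K comon_unit) K (ten_runit _) _ _.
Next Obligation.
move=> K; apply: tenr_ext => k; rewrite /= tenmE ten_runitE.
suff E : alg_cmp (tenm (ten_runit (cm_ob K)) (ten_runit _))
    (alg_cmp (ten_mid _ _ _ _) (purel _ (pure (eta_V T tt) (eta_V T tt)))) = alg_id _.
  by have /= -> := alg_hom_app (E _) (cm_mul K k).
by move=> A; apply: ten_ext => p q; tens.
Qed.
Next Obligation.
move=> K; apply: tenr_ext => k; rewrite /= tenmE ten_runitE.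
suff E : alg_cmp (ten_lunit _) (purel _ (eta_V T tt)) = alg_id (tenunit T).
  by have /= -> := alg_hom_app E (cm_unit K k).
by apply: eta_extu; tens.
Qed.

Program Definition MComon : monoidal (Comon SV sym) :=
  @Monoidal (Comon SV sym) comon_ten comon_tenm _ _ comon_unit comon_assoc comon_lunit comon_runit
    _ _ _ _ _ _ _ _.
Next Obligation. by move=> K L; apply: comonoid_hom_ext; exact: (tnsm1 MV). Qed.
Next Obligation. by move=> *; apply: comonoid_hom_ext; exact: (tnsmM MV). Qed.
Next Obligation. by move=> *; apply: comon_iso; exact: (assoc_iso MV). Qed.
Next Obligation. by move=> *; apply: comon_iso; exact: (lunit_iso MV). Qed.
Next Obligation. by move=> *; apply: comon_iso; exact: (runit_iso MV). Qed.
Next Obligation. by move=> *; apply: comonoid_hom_ext; exact: (assoc_nat MV). Qed.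
Next Obligation. by move=> *; apply: comonoid_hom_ext; exact: (lunit_nat MV). Qed.
Next Obligation. by move=> *; apply: comonoid_hom_ext; exact: (runit_nat MV). Qed.
Next Obligation. by move=> *; apply: comonoid_hom_ext; exact: (pentagon MV). Qed.
Next Obligation. by move=> *; apply: comonoid_hom_ext; exact: (triangle MV). Qed.

(* The comonoid structure on [F_V X]: the comultiplication is the image of the
   diagonal followed by [F_V (X * X) ~ F_V X (x) F_V X]. *)
Lemma FV_prodP (X Y : SET) : exists h : alg_hom (FV T (X * Y)%type) (ten (FV T X) (FV T Y)),
  forall x y, h (eta_V T (x, y)) = pure (eta_V T x) (eta_V T y).
Proof.
have [h hE] := @eta_ex (X * Y)%type (ten (FV T X) (FV T Y))
  (fun z => pure (eta_V T z.1) (eta_V T z.2)).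
by exists h => x y; rewrite hE.
Qed.

Definition FV_prod (X Y : SET) : hom (FV T (X * Y)%type) (tns MV (FV T X) (FV T Y)) :=
  sval (cid (FV_prodP X Y)).

Lemma FV_prod_iso (X Y : SET) : is_iso (FV_prod X Y).
Proof.
have E : forall x y, ah_fun (FV_prod X Y) (eta_V T (x, y)) = pure (eta_V T x) (eta_V T y).
  exact: (svalP (cid (FV_prodP X Y))).
have /choice[f fE] x := @eta_ex Y (FV T (X * Y)%type) (fun y => eta_V T (x, y)).
have [g gE] := @eta_ex X (ihom (FV T Y) (FV T (X * Y)%type)) f.
have [h hE] := uncurryP g.
exists h; split.
- by apply: eta_ext => -[x y]; rewrite /= E hE gE fE.
apply: ten_ext => a b; rewrite /= hE.
suff /alg_hom_app /(_ b) : alg_cmp (FV_prod X Y) (g a : ihom _ _) = purer _ a by [].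
apply: eta_ext => y.
suff /alg_hom_app /(_ a) : alg_cmp (FV_prod X Y)
  (alg_cmp h (purel _ (eta_V T y))) = purel (FV T X) (eta_V T y) by rewrite /= hE.
by apply: eta_ext => x; rewrite /= hE gE fE E.
Qed.

Definition FV_comonoid_data (X : SET) : comonoid_data MV :=
  @ComonoidData _ MV (FV T X)
    (FV_prod X X \;o fmap (FV T) (fun x : X => (x, x) : (X * X)%type))
    (fmap (FV T) (fun _ : X => tt : unit)).

End MonoidalV.

(* [tagnat.Rank i j] is the position of the [j]-th element of the [i]-th block
   in the concatenation of blocks of lengths [n 0, n 1, ...]; [tagnat.sig1] and
   [tagnat.sig2] are the block and the position in it. *)

Lemma sum_reindex k (s : 'S_k) (n : 'I_k -> nat) : \sum_i n (s i) = \sum_i n i.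
Proof. by rewrite [RHS](reindex_inj (@perm_inj _ s)). Qed.

Definition block_perm_fun k (s : 'S_k) (n : 'I_k -> nat) (t : 'I_(\sum_i n (s i))) :
  'I_(\sum_i n (s i)) :=
  cast_ord (esym (sum_reindex s n)) (@tagnat.Rank k n (s (tagnat.sig1 t)) (tagnat.sig2 t)).

Lemma block_perm_inj k (s : 'S_k) (n : 'I_k -> nat) : injective (@block_perm_fun k s n).
Proof.
move=> t u /cast_ord_inj e; rewrite -[t]tagnat.sig2K -[u]tagnat.sig2K.
move: (tagnat.sig1 t) (tagnat.sig2 t) (tagnat.sig1 u) (tagnat.sig2 u) e => i j i' j' /tagnat.rank_inj e.
have /perm_inj ii' : s i = s i' := congr1 (@tag _ _) e.
by case: _ / ii' in j' e *; rewrite (eq_from_Tagged e).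
Qed.

Definition block_perm k (s : 'S_k) (n : 'I_k -> nat) : 'S_(\sum_i n (s i)) :=
  perm (@block_perm_inj k s n).

Definition perm_sum_fun k (n : 'I_k -> nat) (s : forall i, 'S_(n i)) (t : 'I_(\sum_i n i)) :
  'I_(\sum_i n i) :=
  @tagnat.Rank k n (tagnat.sig1 t) (s (tagnat.sig1 t) (tagnat.sig2 t)).

Lemma perm_sum_inj k (n : 'I_k -> nat) (s : forall i, 'S_(n i)) : injective (perm_sum_fun s).
Proof.
move=> t u /tagnat.rank_inj e; rewrite -[t]tagnat.sig2K -[u]tagnat.sig2K.
move: (tagnat.sig1 t) (tagnat.sig2 t) (tagnat.sig1 u) (tagnat.sig2 u) e => i j i' j' e.
have ii' : i = i' := congr1 (@tag _ _) e.
case: _ / ii' in j' e *; congr tagnat.Rank; apply: perm_inj; exact: (eq_from_Tagged e).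
Qed.

Definition perm_sum k (n : 'I_k -> nat) (s : forall i, 'S_(n i)) : 'S_(\sum_i n i) :=
  perm (@perm_sum_inj k n s).

Definition op_eq (W : nat -> Type) m n (v : W m) (w : W n) : Prop :=
  existT W m v = existT W n w.

(* A symmetric operad if [sym] is [true], a non-symmetric one otherwise.
   Equations between operations of provably equal arities are stated in the
   total space [{n & W n}]. The right action is by the group ['S_n], whose
   product [s * t] is [s] followed by [t]. *)
Record operad (sym : bool) := Operad {
  oper :> nat -> Type;
  op_one : oper 1;
  op_comp : forall k, oper k -> forall n : 'I_k -> nat, (forall i, oper (n i)) ->
    oper (\sum_i n i);
  op_onel : forall n (w : oper n), op_eq (op_comp op_one (fun=> w)) w;
  op_oner : forall n (w : oper n), op_eq (op_comp w (fun=> op_one)) w;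
  op_assoc : forall k (w : oper k) (n : 'I_k -> nat) (v : forall i, oper (n i))
      (m : forall i, 'I_(n i) -> nat) (u : forall i (j : 'I_(n i)), oper (m i j)),
    op_eq (op_comp w (fun i => op_comp (v i) (u i)))
          (op_comp (op_comp w v) (fun t => u (tagnat.sig1 t) (tagnat.sig2 t)));
  op_act : sym -> forall n, oper n -> 'S_n -> oper n;
  op_act1 : forall h n (w : oper n), op_act h w 1%g = w;
  op_actM : forall h n (w : oper n) (s t : 'S_n),
    op_act h w (s * t)%g = op_act h (op_act h w s) t;
  op_equiv_out : forall h k (w : oper k) (s : 'S_k) (n : 'I_k -> nat)
      (v : forall i, oper (n i)),
    op_eq (op_comp (op_act h w s) v)
          (op_act h (op_comp w (fun i => v (s i))) (block_perm s n));
  op_equiv_in : forall h k (w : oper k) (n : 'I_k -> nat) (v : forall i, oper (n i))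
      (s : forall i, 'S_(n i)),
    op_comp w (fun i => op_act h (v i) (s i)) = op_act h (op_comp w v) (perm_sum s) }.

Arguments op_comp {_ _ _} _ {_} _.
Arguments op_act {_ _} _ {_} _ _.

Section TensorPower.
Variable T : comm_theory.
Implicit Types A B : alg T.

Fixpoint tpow A n : alg T :=
  match n with
  | 0 => tenunit T
  | n'.+1 => ten A (tpow A n')
  end.

Fixpoint ptens A n : ('I_n -> A) -> tpow A n :=
  match n with
  | 0 => fun=> eta_V T tt
  | n'.+1 => fun x => pure (x ord0) (ptens (fun i => x (lift ord0 i)))
  end.

Definition upd (Y : Type) n (x : 'I_n -> Y) (i : 'I_n) (y : Y) : 'I_n -> Y :=
  fun j => if j == i then y else x j.

Definition multihom A B n (f : ('I_n -> A) -> B) : Prop :=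
  forall x i m p (o : T m p) (y : 'I_m -> A) (j : 'I_p),
    f (upd x i (aop o y j)) = aop o (fun k => f (upd x i (y k))) j.

Definition fcons (Y : Type) n (y : Y) (x : 'I_n -> Y) : 'I_n.+1 -> Y :=
  fun i => if unlift ord0 i is Some j then x j else y.

Lemma fcons0 (Y : Type) n (y : Y) (x : 'I_n -> Y) : fcons y x ord0 = y.
Proof. by rewrite /fcons unlift_none. Qed.

Lemma fconsS (Y : Type) n (y : Y) (x : 'I_n -> Y) i : fcons y x (lift ord0 i) = x i.
Proof. by rewrite /fcons liftK. Qed.

Lemma fcons_eta (Y : Type) n (x : 'I_n.+1 -> Y) :
  fcons (x ord0) (fun i => x (lift ord0 i)) = x.
Proof. by apply: funext => i; rewrite /fcons; case: unliftP => [j|] ->. Qed.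

Lemma upd_fcons0 (Y : Type) n (x : 'I_n -> Y) y z : upd (fcons y x) ord0 z = fcons z x.
Proof.
apply: funext => i; rewrite /upd /fcons.
by case: unliftP => [j|] ->; rewrite ?eqxx // eq_sym (negbTE (neq_lift _ _)).
Qed.

Lemma upd_fconsS (Y : Type) n (x : 'I_n -> Y) y i z :
  upd (fcons y x) (lift ord0 i) z = fcons y (upd x i z).
Proof.
apply: funext => j; rewrite /upd /fcons.
case: unliftP => [j'|] ->; first by rewrite (inj_eq lift_inj).
by rewrite (negbTE (neq_lift _ _)).
Qed.

Lemma upd_comp (Y Z : Type) (f : Y -> Z) n (x : 'I_n -> Y) i y :
  (fun j => f (upd x i y j)) = upd (fun j => f (x j)) i (f y).
Proof. by apply: funext => j; rewrite /upd; case: eqP. Qed.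

Lemma ptens_cons A n (a : A) (x : 'I_n -> A) : ptens (fcons a x) = pure a (ptens x).
Proof.
rewrite /= fcons0; congr pure; congr ptens; apply: funext => i; exact: fconsS.
Qed.

Lemma ptens_multi A n : multihom (@ptens A n).
Proof.
elim: n => [|n ih] x i m p o y j; first by case: i.
rewrite -(fcons_eta x); case: (unliftP ord0 i) => [i' ->|->].
- rewrite upd_fconsS ptens_cons ih pure_homr; congr aop; apply: funext => k /=.
  by rewrite upd_fconsS -ptens_cons.
- rewrite upd_fcons0 ptens_cons pure_homl; congr aop; apply: funext => k.
  by rewrite upd_fcons0 ptens_cons.
Qed.

Lemma tpow_ext A B n (h k : alg_hom (tpow A n) B) :
  (forall x, h (ptens x) = k (ptens x)) -> h = k.
Proof.
elim: n h k => [|n ih] h k e.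
  have x0 : 'I_0 -> A by case.
  exact/eta_extu/(e x0).
apply: ten_ext => a t.
suff /alg_hom_app /(_ t) : alg_cmp h (purer _ a) = alg_cmp k (purer _ a) by [].
by apply: ih => x; rewrite /= -ptens_cons.
Qed.

Lemma tpow_lift A B n (f : ('I_n -> A) -> B) : multihom f ->
  exists h : alg_hom (tpow A n) B, forall x, h (ptens x) = f x.
Proof.
elim: n f => [|n ih] f fm.
  have x0 : 'I_0 -> A by case.
  have [h hE] := @eta_ex T unit B (fun=> f x0).
  by exists h => x; rewrite hE; congr f; apply: funext => -[].
have /choice[g gE] a : exists h : alg_hom (tpow A n) B, forall x, h (ptens x) = f (fcons a x).
  apply: ih => x i m p o y j; rewrite -upd_fconsS fm.
  by congr aop; apply: funext => k; rewrite upd_fconsS.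
have gh : @is_hom T A (ihom (tpow A n) B) g.
  move=> m p o y j; apply: tpow_ext => x; rewrite gE ihom_opE.
  have z : A := aop o y j.
  rewrite -(upd_fcons0 _ z) fm; congr aop; apply: funext => k /=.
  by rewrite gE upd_fcons0.
have [h hE] := uncurryP (AlgHom gh); exists h => x.
by rewrite /= hE /= gE fcons_eta.
Qed.

End TensorPower.

Section OperadAlgebras.
Variables (T : comm_theory) (sym : bool) (W : operad sym).

(* A [W]-algebra in [V]: maps [W(n) -> Hom_V(V^{(x) n}, V)]; the compatibility
   equations between homomorphisms out of tensor powers are given on pure
   tensors, which detect equality by [tpow_ext]. *)
Record walg_on (Y : Type) := WAlgOn {
  wbase : alg_on T Y;
  wact : forall n, W n -> alg_hom (tpow (Alg wbase) n) (Alg wbase);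
  wact_one : forall x : 'I_1 -> Alg wbase, wact (op_one W) (ptens x) = x ord0;
  wact_comp : forall k (w : W k) (n : 'I_k -> nat) (v : forall i, W (n i))
      (x : 'I_(\sum_i n i) -> Alg wbase),
    wact (op_comp w v) (ptens x) =
    wact w (ptens (fun i => wact (v i) (ptens (fun j => x (@tagnat.Rank k n i j)))));
  wact_act : forall (h : sym) n (w : W n) (s : 'S_n) (x : 'I_n -> Alg wbase),
    wact (op_act h w s) (ptens x) = wact w (ptens (fun i => x (s i))) }.

Record walg := WAlg {
  walg_car :> Type;
  walg_str : walg_on walg_car }.

Definition walg_alg (A : walg) : alg T := Alg (wbase (walg_str A)).

Definition wop (A : walg) n (w : W n) (x : 'I_n -> A) : A :=
  wact (walg_str A) w (@ptens T (walg_alg A) n x).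

Definition is_whom (A B : walg) (f : A -> B) : Prop :=
  @is_hom T (walg_alg A) (walg_alg B) f /\
  forall n (w : W n) (x : 'I_n -> A), f (wop w x) = wop w (f \o x).

Record walg_hom (A B : walg) := WAlgHom {
  wh_fun :> A -> B;
  wh_hom : is_whom wh_fun }.

Lemma walg_hom_ext (A B : walg) (f g : walg_hom A B) : (forall x, f x = g x) -> f = g.
Proof.
case: f g => [f p] [g q] /= /funext e; case: _ / e in q *.
by congr WAlgHom; apply: Prop_irrelevance.
Qed.

Lemma eq_is_whom (A B : walg) (f g : A -> B) : f =1 g -> is_whom f -> is_whom g.
Proof. by move=> /funext ->. Qed.

Program Definition walg_id (A : walg) : walg_hom A A := @WAlgHom A A (fun x => x) _.
Next Obligation. by []. Qed.

Program Definition walg_cmp (A B C : walg) (g : walg_hom B C) (f : walg_hom A B) :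
  walg_hom A C := @WAlgHom A C (fun x => g (f x)) _.
Next Obligation.
move=> A B C [g [g1 g2]] [f [f1 f2]] /=; split=> [n m o x j|n w x].
- by rewrite f1 g1.
- by rewrite f2 g2.
Qed.

Program Definition UAlg : category :=
  @Category walg walg_hom walg_id walg_cmp _ _ _.
Next Obligation. by move=> *; apply: walg_hom_ext. Qed.
Next Obligation. by move=> *; apply: walg_hom_ext. Qed.
Next Obligation. by move=> *; apply: walg_hom_ext. Qed.

Program Definition forget_US : functor UAlg SET :=
  @Functor UAlg SET walg_car (fun A B (f : walg_hom A B) => wh_fun f) _ _.
Next Obligation. by []. Qed.
Next Obligation. by []. Qed.

Program Definition forget_UV : functor UAlg (VAlg T) :=
  @Functor UAlg (VAlg T) walg_alg
    (fun A B (f : walg_hom A B) => @AlgHom T (walg_alg A) (walg_alg B) f (proj1 (wh_hom f))) _ _.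
Next Obligation. by move=> *; apply: alg_hom_ext. Qed.
Next Obligation. by move=> *; apply: alg_hom_ext. Qed.

Lemma wop_multi (A : walg) n (w : W n) : @multihom T (walg_alg A) (walg_alg A) n (wop w).
Proof.
move=> x i m p o y j; rewrite /wop ptens_multi ah_hom.
by congr aop; apply: funext.
Qed.

Section MakeWAlg.
Variables (Y : Type) (base : alg_on T Y).
Notation A := (Alg base).
Variable act : forall n, W n -> ('I_n -> Y) -> Y.
Hypothesis act_multi : forall n (w : W n), @multihom T A A n (act w).
Hypothesis act_one : forall x, act (op_one W) x = x ord0.
Hypothesis act_comp : forall k (w : W k) (n : 'I_k -> nat) (v : forall i, W (n i)) x,
  act (op_comp w v) x = act w (fun i => act (v i) (fun j => x (@tagnat.Rank k n i j))).
Hypothesis act_act : forall (h : sym) n (w : W n) (s : 'S_n) x,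
  act (op_act h w s) x = act w (fun i => x (s i)).

Definition mk_wact n (w : W n) : alg_hom (tpow A n) A := sval (cid (tpow_lift (act_multi w))).

Lemma mk_wactE n (w : W n) x : mk_wact w (ptens x) = act w x.
Proof. exact: (svalP (cid (tpow_lift (act_multi w)))). Qed.

Program Definition mk_walg_on : walg_on Y := @WAlgOn Y base mk_wact _ _ _.
Next Obligation. by move=> x; rewrite mk_wactE. Qed.
Next Obligation.
move=> k w n v x; rewrite !mk_wactE act_comp.
by congr act; apply: funext => i; rewrite mk_wactE.
Qed.
Next Obligation. by move=> h n w s x; rewrite !mk_wactE. Qed.

Lemma mk_wopE n (w : W n) (x : 'I_n -> Y) : @wop (WAlg mk_walg_on) n w x = act w x.
Proof. exact: mk_wactE. Qed.

End MakeWAlg.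

Lemma wop_one (A : walg) (x : 'I_1 -> A) : wop (op_one W) x = x ord0.
Proof. exact: (@wact_one _ (walg_str A) x). Qed.

Lemma wop_comp (A : walg) k (w : W k) (n : 'I_k -> nat) (v : forall i, W (n i))
    (x : 'I_(\sum_i n i) -> A) :
  wop (op_comp w v) x = wop w (fun i => wop (v i) (fun j => x (@tagnat.Rank k n i j))).
Proof. exact: (@wact_comp _ (walg_str A) k w n v x). Qed.

Lemma wop_act (A : walg) (h : sym) n (w : W n) (s : 'S_n) (x : 'I_n -> A) :
  wop (op_act h w s) x = wop w (fun i => x (s i)).
Proof. exact: (@wact_act _ (walg_str A) h n w s x). Qed.

Lemma wop_multiE (A : walg) n (w : W n) (x : 'I_n -> A) i m p (o : T m p) (y : 'I_m -> A) j :
  wop w (upd x i (@aop T (walg_alg A) _ _ o y j)) =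
  @aop T (walg_alg A) _ _ o (fun k => wop w (upd x i (y k))) j.
Proof. exact: wop_multi. Qed.

(* The structure determined by a jointly injective family of maps preserving
   the operations. *)
Section JointWAlg.
Variables (Q I : Type) (A : I -> walg).
Variables (q : forall n m, T n m -> ('I_n -> Q) -> 'I_m -> Q).
Variables (r : forall n, W n -> ('I_n -> Q) -> Q).
Variable pi : forall i, Q -> A i.
Hypothesis pi_q : forall i n m (o : T n m) x j,
  pi i (q o x j) = @aop T (walg_alg (A i)) _ _ o (fun k => pi i (x k)) j.
Hypothesis pi_r : forall i n (w : W n) x, pi i (r w x) = wop w (fun k => pi i (x k)).
Hypothesis pi_inj : forall x y, (forall i, pi i x = pi i y) -> x = y.

Let base : alg_on T Q := @joint_alg_on T Q I (fun i => walg_alg (A i)) q pi pi_q pi_inj.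

Lemma joint_walg_multi n (w : W n) : @multihom T (Alg base) (Alg base) n (r w).
Proof.
move=> x i m p o y j; apply: pi_inj => a; rewrite /aop /= pi_q !pi_r upd_comp pi_q wop_multiE.
apply: (congr1 (fun z => @aop T (walg_alg (A a)) _ _ o z j)); apply: funext => k; by rewrite pi_r upd_comp.
Qed.

Lemma joint_walg_one x : r (op_one W) x = x ord0.
Proof. by apply: pi_inj => a; rewrite pi_r wop_one. Qed.

Lemma joint_walg_comp k (w : W k) (n : 'I_k -> nat) (v : forall i, W (n i)) x :
  r (op_comp w v) x = r w (fun i => r (v i) (fun j => x (@tagnat.Rank k n i j))).
Proof.
apply: pi_inj => a; rewrite !pi_r wop_comp.
by congr wop; apply: funext => i; rewrite pi_r.
Qed.

Lemma joint_walg_act (h : sym) n (w : W n) (s : 'S_n) x : r (op_act h w s) x = r w (fun i => x (s i)).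
Proof. by apply: pi_inj => a; rewrite !pi_r wop_act. Qed.

Definition joint_walg : walg :=
  WAlg (mk_walg_on joint_walg_multi joint_walg_one joint_walg_comp joint_walg_act).

Lemma joint_wopE n (w : W n) x : @wop joint_walg n w x = r w x.
Proof. exact: mk_wopE. Qed.

Lemma joint_walg_pi i : @is_whom joint_walg (A i) (pi i).
Proof. by split=> [n m o x j|n w x]; [exact: pi_q|rewrite joint_wopE pi_r]. Qed.

End JointWAlg.

Section GenWAlg.
Variables (X : Type) (P : forall A : walg, (X -> A) -> Prop).

Record gen_walg := GenWAlg {
  gw :> walg;
  gw_gen : X -> gw;
  gw_pi : forall (A : walg) (rho : X -> A), P rho -> walg_hom gw A;
  gw_piE : forall (A : walg) (rho : X -> A) (p : P rho) x, gw_pi p (gw_gen x) = rho x;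
  gw_inj : forall x y,
    (forall (A : walg) (rho : X -> A) (p : P rho), gw_pi p x = gw_pi p y) -> x = y;
  gw_ext : forall (B : walg) (f g : walg_hom gw B),
    (forall x, f (gw_gen x) = g (gw_gen x)) -> f = g }.

Lemma gen_walgP : gen_walg.
Proof.
pose S := ({n : nat & {m : nat & (T n m * 'I_m)%type}} + {n : nat & W n})%type.
pose ar (s : S) := match s with inl s => tag s | inr s => tag s end.
pose I := {A : walg & {rho : X -> A | P rho}}.
pose A (i : I) : Type := tag i.
pose str i (s : S) : ('I_(ar s) -> A i) -> A i :=
  match s with
  | inl (existT n (existT m (o, j))) => fun x => @aop T (walg_alg (tag i)) _ _ o x j
  | inr (existT n w) => fun x => wop w x
  end.
pose rho (i : I) : X -> A i := sval (tagged i).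
have J := joint_quotientP str rho.
pose q n m (o : T n m) (x : 'I_n -> jq J) (j : 'I_m) : jq J :=
  @jq_op _ _ _ _ _ _ _ J (inl (existT _ n (existT _ m (o, j)))) x.
pose r n (w : W n) (x : 'I_n -> jq J) : jq J :=
  @jq_op _ _ _ _ _ _ _ J (inr (existT _ n w)) x.
pose pi (i : I) : jq J -> (tag i : walg) := @jq_pi _ _ _ _ _ _ _ J i.
have pi_q (i : I) n m (o : T n m) x j :
    pi i (q n m o x j) = @aop T (walg_alg (tag i)) _ _ o (fun k => pi i (x k)) j.
  by rewrite /pi jq_pi_op.
have pi_r (i : I) n (w : W n) x : pi i (r n w x) = wop w (fun k => pi i (x k)).
  by rewrite /pi jq_pi_op.
pose QA := joint_walg pi_q pi_r (@jq_inj _ _ _ _ _ _ _ J).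
have hpi (i : I) : @is_whom QA (tag i) (pi i) by exact: joint_walg_pi.
exists QA (@jq_gen _ _ _ _ _ _ _ J) (fun B f p => WAlgHom (hpi (existT _ B (exist _ f p)))).
- by move=> B f p x; rewrite /= /pi jq_pi_gen.
- by move=> x y e; apply: (@jq_inj _ _ _ _ _ _ _ J) => -[B [f p]]; apply: (e B f p).
move=> B f g e; apply: walg_hom_ext; apply: (@jq_ind _ _ _ _ _ _ _ J) => // -[t|t] x ih.
- case: t x ih => n [m [o j]] x ih; rewrite -/(q n m o x j).
  rewrite -[q n m o x j]/(@aop T (walg_alg QA) _ _ o x j).
  rewrite (proj1 (wh_hom f)) (proj1 (wh_hom g)).
  by apply: (congr1 (fun z => @aop T (walg_alg B) _ _ o z j)); apply: funext => k; apply: ih.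
- case: t x ih => n w x ih; rewrite -/(r n w x).
  rewrite -(@joint_wopE (jq J) I (fun i => tag i) q r pi pi_q pi_r (@jq_inj _ _ _ _ _ _ _ J) n w x).
  rewrite (proj2 (wh_hom f)) (proj2 (wh_hom g)).
  by congr wop; apply: funext => k; apply: ih.
Qed.

End GenWAlg.

Lemma free_UV (A : VAlg T) : universal_arrow forget_UV A.
Proof.
have G := @gen_walgP A (fun B f => @is_hom T A (walg_alg B) f).
have gh : @is_hom T A (walg_alg G) (@gw_gen _ _ G).
  move=> n m o x j; apply: (@gw_inj _ _ G) => B f p.
  rewrite gw_piE p (proj1 (wh_hom (gw_pi G p))).
  by apply: (congr1 (fun z => @aop T (walg_alg B) _ _ o z j)); apply: funext => k; rewrite /= gw_piE.
exists (gw G : UAlg) (@AlgHom T A (walg_alg G) _ gh)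
  (fun (B : UAlg) (f : alg_hom A (walg_alg B)) => @gw_pi _ _ G B f (ah_hom f)).
- by move=> B f; apply: alg_hom_ext => x; rewrite /= gw_piE.
- by move=> B h k e; apply: gw_ext => x; have /= := alg_hom_app e x.
Qed.

Lemma free_US (X : SET) : universal_arrow forget_US X.
Proof.
have G := @gen_walgP X (fun _ _ => True).
exists (gw G : UAlg) (@gw_gen _ _ G) (fun (B : UAlg) f => @gw_pi _ _ G B f I).
- by move=> B f; apply: funext => x; rewrite /= gw_piE.
- by move=> B h k e; apply: gw_ext => x; have := congr1 (fun f => f x) e.
Qed.

Definition FUV : functor (VAlg T) UAlg := left_adjoint free_UV.
Definition FU : functor SET UAlg := left_adjoint free_US.

Definition eta_U (X : Type) : X -> FU X := ua_unit (free_US X).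

End OperadAlgebras.

Section CoAlgebras.
Variables (T : comm_theory) (sym : bool) (W : operad sym).
Local Notation U := (UAlg T W).
Local Notation walg := (walg T W).
Implicit Types A B : walg.

(* An object [X] with a lift of [Hom_U(X,-)] to a functor from [U] to [U]. *)
Record coalg := CoAlg {
  co_ob :> walg;
  co_lift : forall A, walg_on T W (walg_hom co_ob A);
  co_nat : forall A B (g : walg_hom A B),
    @is_whom T sym W (WAlg (co_lift A)) (WAlg (co_lift B)) (fun h => walg_cmp g h) }.

Lemma walg_hom_app A B (f g : walg_hom A B) (e : f = g) x : f x = g x.
Proof. by rewrite e. Qed.

Definition Hom (X : coalg) A : walg := WAlg (co_lift X A).

Program Definition HomF (X : coalg) : functor U U :=
  @Functor U U (Hom X) (fun A B g => @WAlgHom T sym W (Hom X A) (Hom X B) _ (co_nat X g)) _ _.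
Next Obligation. by move=> X A; apply: walg_hom_ext => h; apply: walg_hom_ext. Qed.
Next Obligation. by move=> X A B C g f; apply: walg_hom_ext => h; apply: walg_hom_ext. Qed.

Record coalg_hom (X Y : coalg) := CoAlgHom {
  ch :> walg_hom X Y;
  ch_hom : forall A, @is_whom T sym W (Hom Y A) (Hom X A) (fun h => walg_cmp h ch) }.

Lemma coalg_hom_ext (X Y : coalg) (f g : coalg_hom X Y) :
  (forall x, f x = g x) -> f = g.
Proof.
case: f g => [f p] [g q] /= /walg_hom_ext e; case: _ / e in q *.
by congr CoAlgHom; apply: Prop_irrelevance.
Qed.

Program Definition coalg_id (X : coalg) : coalg_hom X X := @CoAlgHom X X (walg_id X) _.
Next Obligation.
move=> X A; apply: (@eq_is_whom _ _ _ (Hom X A) (Hom X A) (fun h => h)); last by [].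
by move=> h; apply: walg_hom_ext.
Qed.

Program Definition coalg_cmp (X Y Z : coalg) (g : coalg_hom Y Z) (f : coalg_hom X Y) :
  coalg_hom X Z := @CoAlgHom X Z (walg_cmp g f) _.
Next Obligation.
move=> X Y Z g f A.
have := wh_hom (walg_cmp (WAlgHom (@ch_hom _ _ f A)) (WAlgHom (@ch_hom _ _ g A))).
apply: eq_is_whom => h; exact: walg_hom_ext.
Qed.

Program Definition UCo : category :=
  @Category coalg coalg_hom coalg_id coalg_cmp _ _ _.
Next Obligation. by move=> *; apply: coalg_hom_ext. Qed.
Next Obligation. by move=> *; apply: coalg_hom_ext. Qed.
Next Obligation. by move=> *; apply: coalg_hom_ext. Qed.

Program Definition forget_co : functor UCo U :=
  @Functor UCo U co_ob (fun X Y (f : coalg_hom X Y) => ch f) _ _.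
Next Obligation. by []. Qed.
Next Obligation. by []. Qed.

Definition pre (X Y : coalg) (f : coalg_hom X Y) A : walg_hom (Hom Y A) (Hom X A) :=
  WAlgHom (@ch_hom _ _ f A).

(* The co-[U]-algebra structure on [X] transported along a natural bijection
   of [Hom_U(X, A)] with the carrier of a [U]-algebra [L A]. *)
Section Transport.
Variables (X : walg) (L : functor U U).
Variable phi : forall A, walg_hom X A -> (L A : walg).
Variable psi : forall A, (L A : walg) -> walg_hom X A.
Hypothesis phiK : forall A, cancel (@phi A) (@psi A).
Hypothesis psiK : forall A, cancel (@psi A) (@phi A).
Hypothesis phi_nat : forall A B (g : walg_hom A B) h,
  phi (walg_cmp g h) = (fmap L g : walg_hom _ _) (phi h).

Definition tr_walg A : walg := @joint_walg T sym W (walg_hom X A) unit (fun=> L A)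
  (fun n m o x j => psi (@aop T (walg_alg (L A)) _ _ o (fun k => phi (x k)) j))
  (fun n w x => psi (wop w (fun k => phi (x k))))
  (fun=> @phi A) (fun _ _ _ _ _ _ => psiK _) (fun _ _ _ _ => psiK _)
  (fun x y e => can_inj (@phiK A) (e tt)).

Lemma tr_phi A : @is_whom T sym W (tr_walg A) (L A) (@phi A).
Proof.
exact: (@joint_walg_pi T sym W (walg_hom X A) unit (fun=> L A) _ _ (fun=> @phi A)).
Qed.

Lemma tr_psi A : @is_whom T sym W (L A) (tr_walg A) (@psi A).
Proof.
split=> [n m o x j|n w x]; apply: (can_inj (@phiK A)); rewrite psiK.
- rewrite (proj1 (tr_phi A)).
  by apply: (congr1 (fun z => @aop T (walg_alg (L A)) _ _ o z j)); apply: funext => k /=; rewrite psiK.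
- rewrite (proj2 (tr_phi A)).
  by congr wop; apply: funext => k /=; rewrite psiK.
Qed.

Lemma tr_nat A B (g : walg_hom A B) :
  @is_whom T sym W (tr_walg A) (tr_walg B) (fun h => walg_cmp g h).
Proof.
have := wh_hom (walg_cmp (WAlgHom (tr_psi B)) (walg_cmp (fmap L g : walg_hom _ _) (WAlgHom (tr_phi A)))).
apply: eq_is_whom => h /=.
by rewrite -phi_nat phiK.
Qed.

Definition tr_coalg : coalg :=
  @CoAlg X (fun A => walg_str (tr_walg A)) tr_nat.

Program Definition tr_iso : nat_iso (HomF tr_coalg) L :=
  @NatIso U U (HomF tr_coalg) L
    (fun A => @WAlgHom T sym W (Hom tr_coalg A) (L A) (@phi A) (tr_phi A)) _ _.
Next Obligation. by move=> A B g; apply: walg_hom_ext => h; exact: phi_nat. Qed.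
Next Obligation.
move=> A; exists (@WAlgHom T sym W (L A) (Hom tr_coalg A) (@psi A) (tr_psi A)).
by split; apply: walg_hom_ext => h /=; [exact: phiK|exact: psiK].
Qed.

End Transport.

Section Power.
Variables (A : walg) (X : Type).

Definition walg_pow : walg := @joint_walg T sym W (X -> A) X (fun=> A)
  (fun n m o f j x => @aop T (walg_alg A) _ _ o (fun k => f k x) j)
  (fun n w f x => wop w (fun k => f k x))
  (fun x f => f x) (fun _ _ _ _ _ _ => erefl) (fun _ _ _ _ => erefl)
  (fun f g e => funext e).

Lemma walg_pow_ev x : @is_whom T sym W walg_pow A (fun f => f x).
Proof. exact: (@joint_walg_pi T sym W (X -> A) X (fun=> A) _ _ (fun x f => f x)). Qed.

Lemma walg_pow_hom (B : walg) (f : B -> walg_pow) :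
  (forall x, @is_whom T sym W B A (fun b => f b x)) -> is_whom f.
Proof.
move=> fh; split=> [n m o y j|n w y]; apply: funext => x.
- by rewrite (proj1 (fh x)) (proj1 (walg_pow_ev x)).
- by rewrite (proj2 (fh x)) (proj2 (walg_pow_ev x)).
Qed.

End Power.

Lemma walg_pow_map A B (X Y : Type) (g : walg_hom A B) (f : X -> Y) :
  @is_whom T sym W (walg_pow A Y) (walg_pow B X) (fun h x => g (h (f x))).
Proof.
apply: walg_pow_hom => x.
exact: (wh_hom (walg_cmp g (WAlgHom (walg_pow_ev A (f x))))).
Qed.

Program Definition PowF (X : Type) : functor U U :=
  @Functor U U (fun A => walg_pow A X)
    (fun A B g => WAlgHom (@walg_pow_map A B X X g (fun x => x))) _ _.
Next Obligation. by move=> *; apply: walg_hom_ext. Qed.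
Next Obligation. by move=> *; apply: walg_hom_ext. Qed.

Section HatFU.
Variable X : SET.
Let phi A (h : walg_hom (FU T W X) A) : (PowF X A : walg) := fun x : X => h (eta_U T W x).
Let psi A (f : (PowF X A : walg)) : walg_hom (FU T W X) A :=
  ua_ext (free_US T W X) (Y := A : U) f.

Lemma hatFU_phiK A : cancel (@phi A) (@psi A).
Proof.
move=> h; apply: (ua_uniq (u := free_US T W X)).
exact: (@ua_extE _ _ _ _ (free_US T W X) A).
Qed.

Lemma hatFU_psiK A : cancel (@psi A) (@phi A).
Proof. move=> f; exact: (@ua_extE _ _ _ _ (free_US T W X) A). Qed.

(* [F_U X] with [Hom_U(F_U X, A) ~ A^X] an isomorphism of [U]-algebras. *)
Definition hatFU_ob : UCo := @tr_coalg (FU T W X) (PowF X) phi psi hatFU_phiK hatFU_psiK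
  (fun A B g h => erefl).

Definition hatFU_iso : nat_iso (HomF hatFU_ob) (PowF X) :=
  @tr_iso (FU T W X) (PowF X) phi psi hatFU_phiK hatFU_psiK (fun A B g h => erefl).

Lemma hatFU_isoE A (h : walg_hom (FU T W X) A) :
  (hatFU_iso A : walg_hom (Hom hatFU_ob A) (walg_pow A X)) h = fun x => h (eta_U T W x).
Proof. by []. Qed.

End HatFU.

Program Definition hatFU : functor SET UCo :=
  @Functor SET UCo hatFU_ob
    (fun X Y f => @CoAlgHom (hatFU_ob X) (hatFU_ob Y) (fmap (FU T W) f) _) _ _.
Next Obligation.
move=> X Y f A.
have h1 := tr_psi (@hatFU_phiK X) (@hatFU_psiK X) A.
have h2 := tr_phi (@hatFU_phiK Y) (@hatFU_psiK Y) A.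
have h3 := walg_pow_map (walg_id A) f.
have := wh_hom (walg_cmp (WAlgHom h1) (walg_cmp (WAlgHom h3) (WAlgHom h2))).
apply: eq_is_whom => h; apply: (can_inj (@hatFU_phiK X A)); rewrite /= hatFU_psiK.
apply: funext => x; rewrite /=; congr (wh_fun h _).
have /= e := @ua_extE _ _ _ _ (free_US T W X) (FU T W Y) (fun x => eta_U T W (f x)).
exact: (esym (congr1 (fun g => g x) e)).
Qed.
Next Obligation. by move=> X; apply: coalg_hom_ext => x; have /= -> := fmap1 (FU T W) X. Qed.
Next Obligation.
move=> X Y Z g f; apply: coalg_hom_ext => x; by have /= -> := fmapM (FU T W) g f.
Qed.

Lemma hatFU_lift : comp_functor forget_co hatFU = FU T W.
Proof. by congr Functor; apply: Prop_irrelevance. Qed.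

Record corepresentation (L : functor U U) := Corepresentation {
  cr_ob :> UCo;
  cr_iso : nat_iso (HomF cr_ob) L }.

(* [Hom(S (.) T, A) ~ Hom(S, Hom(T, A))] and [Hom(I, A) ~ A]. *)
Lemma tw_prodP (X Y : UCo) : corepresentation (comp_functor (HomF X) (HomF Y)).
Proof.
pose P A (r : X * Y -> A) : Prop :=
  exists h : walg_hom (co_ob X) (Hom Y A), forall x y, r (x, y) = (h x : walg_hom _ _) y.
have G := @gen_walgP T sym W (X * Y)%type P.
have gh x : @is_whom T sym W Y G (fun y => gw_gen G (x, y)).
  split=> [n m o y j|n w y]; apply: gw_inj => A r p; have [h hE] := p; rewrite gw_piE hE.
  - rewrite (proj1 (wh_hom _)) (proj1 (wh_hom _)).
    by apply: (congr1 (fun z => @aop T (walg_alg A) _ _ o z j)); apply: funext => k; rewrite /= gw_piE hE.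
  - rewrite (proj2 (wh_hom _)) (proj2 (wh_hom _)).
    by congr wop; apply: funext => k; rewrite /= gw_piE hE.
pose io (x : X) : Hom Y G := WAlgHom (gh x).
have pio A r (p : P A r) (h : walg_hom (co_ob X) (Hom Y A)) :
    (forall x y, r (x, y) = (h x : walg_hom _ _) y) ->
    forall x, (fmap (HomF Y) (gw_pi G p) : walg_hom (Hom Y G) (Hom Y A)) (io x) = h x.
  by move=> hE x; apply: walg_hom_ext => y; rewrite /= gw_piE hE.
have ioh : @is_whom T sym W X (Hom Y G) io.
  split=> [n m o x j|n w x]; apply: walg_hom_ext => y; apply: (@gw_inj _ _ _ _ _ G) => A r p;
    have [h hE] := p; have e := pio A r p h hE.
  - rewrite -[LHS]/((fmap (HomF Y) (gw_pi G p) : walg_hom (Hom Y G) (Hom Y A)) (io _) y) e.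
    rewrite -[RHS]/((fmap (HomF Y) (gw_pi G p) : walg_hom (Hom Y G) (Hom Y A)) _ y).
    rewrite (proj1 (wh_hom _)) [in RHS](proj1 (wh_hom _)).
    by apply: (congr1 (fun z => (@aop T (walg_alg (Hom Y A)) _ _ o z j : walg_hom _ _) y));
       apply: funext => k; rewrite /= -e.
  - rewrite -[LHS]/((fmap (HomF Y) (gw_pi G p) : walg_hom (Hom Y G) (Hom Y A)) (io _) y) e.
    rewrite -[RHS]/((fmap (HomF Y) (gw_pi G p) : walg_hom (Hom Y G) (Hom Y A)) _ y).
    rewrite (proj2 (wh_hom _)) [in RHS](proj2 (wh_hom _)).
    by apply: (congr1 (fun z => (@wop T sym W (Hom Y A) n w z : walg_hom _ _) y));
       apply: funext => k; rewrite /= -e.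
pose ioH : walg_hom X (Hom Y G) := WAlgHom ioh.
pose L := comp_functor (HomF X) (HomF Y).
pose phi A (u : walg_hom G A) : (L A : walg) :=
  walg_cmp (fmap (HomF Y) u : walg_hom (Hom Y G) (Hom Y A)) ioH : walg_hom X (Hom Y A).
have pP A (h : walg_hom X (Hom Y A)) : P A (fun z => (h z.1 : walg_hom _ _) z.2).
  by exists h.
pose psi A (h : (L A : walg)) : walg_hom G A := gw_pi G (pP A h).
have phiK A : cancel (phi A) (psi A).
  by move=> u; apply: (@gw_ext _ _ _ _ _ G) => -[x y]; rewrite gw_piE.
have psiK A : cancel (psi A) (phi A).
  move=> h; apply: walg_hom_ext => x; apply: walg_hom_ext => y.
  by rewrite /= gw_piE.
have phi_nat A B (g : walg_hom A B) u :
    phi B (walg_cmp g u) = (fmap L g : walg_hom (L A : walg) (L B : walg)) (phi A u).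
  by apply: walg_hom_ext => x; apply: walg_hom_ext => y.
exact: (Corepresentation (@tr_iso G L phi psi phiK psiK phi_nat)).
Qed.

Lemma tw_unitP : corepresentation (id_functor U).
Proof.
pose e : FU T W unit := eta_U T W tt.
pose phi A (u : walg_hom (FU T W unit) A) : (id_functor U A : walg) := u e.
pose psi A (a : (id_functor U A : walg)) : walg_hom (FU T W unit) A :=
  ua_ext (free_US T W unit) (Y := A : U) (fun=> a).
have psiK A : cancel (psi A) (phi A).
  move=> a; have /= E := @ua_extE _ _ _ _ (free_US T W unit) A (fun=> a).
  exact: (congr1 (fun g => g tt) E).
have phiK A : cancel (phi A) (psi A).
  move=> h; apply: (ua_uniq (u := free_US T W unit)); apply: funext => -[].
  exact: psiK.
exact: (Corepresentation (@tr_iso (FU T W unit) (id_functor U) phi psi phiK psiK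
  (fun A B g u => erefl))).
Qed.

Definition tw (X Y : UCo) : UCo := tw_prodP X Y.
Definition twI : UCo := tw_unitP.

Definition tw_iso (X Y : UCo) : nat_iso (HomF (tw X Y)) (comp_functor (HomF X) (HomF Y)) :=
  cr_iso (tw_prodP X Y).
Definition twI_iso : nat_iso (HomF twI) (id_functor U) := cr_iso tw_unitP.

Definition tw_phi (X Y : UCo) A : walg_hom (Hom (tw X Y) A) (Hom X (Hom Y A)) := tw_iso X Y A.
Definition tw_psi (X Y : UCo) A : walg_hom (Hom X (Hom Y A)) (Hom (tw X Y) A) :=
  sval (cid (ni_iso (tw_iso X Y) A)).

Lemma tw_phiK X Y A (u : Hom (tw X Y) A) : tw_psi X Y A (tw_phi X Y A u) = u.
Proof.
have [e _] := svalP (cid (ni_iso (tw_iso X Y) A)).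
exact: (congr1 (fun f : walg_hom _ _ => f u) e).
Qed.

Lemma tw_psiK X Y A (h : Hom X (Hom Y A)) : tw_phi X Y A (tw_psi X Y A h) = h.
Proof.
have [_ e] := svalP (cid (ni_iso (tw_iso X Y) A)).
exact: (congr1 (fun f : walg_hom _ _ => f h) e).
Qed.

Definition twI_phi A : walg_hom (Hom twI A) A := twI_iso A.
Definition twI_psi A : walg_hom A (Hom twI A) := sval (cid (ni_iso twI_iso A)).

Lemma twI_phiK A (u : Hom twI A) : twI_psi A (twI_phi A u) = u.
Proof.
have [e _] := svalP (cid (ni_iso twI_iso A)).
exact: (congr1 (fun f : walg_hom _ _ => f u) e).
Qed.

Lemma twI_psiK A (a : A) : twI_phi A (twI_psi A a) = a.
Proof.
have [_ e] := svalP (cid (ni_iso twI_iso A)).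
exact: (congr1 (fun f : walg_hom _ _ => f a) e).
Qed.

(* The universal elements [x (.) y] and [i], the images of the identities. *)
Definition odot (X Y : UCo) (x : co_ob X) (y : co_ob Y) : co_ob (tw X Y) :=
  ((tw_phi X Y (tw X Y) (walg_id (tw X Y)) : walg_hom X (Hom Y (tw X Y))) x :
    walg_hom Y (tw X Y)) y.

Definition iI : co_ob twI := twI_phi twI (walg_id twI).

Lemma tw_phiE (X Y : UCo) A (u : walg_hom (tw X Y) A) x y :
  ((tw_phi X Y A u : walg_hom X (Hom Y A)) x : walg_hom Y A) y = u (odot x y).
Proof.
have /= e := ni_nat (tw_iso X Y) (u : hom (co_ob (tw X Y) : U) (A : U)).
have {}e := walg_hom_app e (walg_id (tw X Y) : Hom (tw X Y) (tw X Y)).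
rewrite /= (_ : walg_cmp u (walg_id (tw X Y)) = u) in e; last exact: walg_hom_ext.
exact: (congr1 (fun f : walg_hom X (Hom Y A) => (f x : walg_hom Y A) y) e).
Qed.

Lemma twI_phiE A (u : walg_hom twI A) : twI_phi A u = u iI.
Proof.
have /= e := ni_nat twI_iso (u : hom (co_ob twI : U) (A : U)).
have {}e := walg_hom_app e (walg_id twI : Hom twI twI).
by rewrite /= (_ : walg_cmp u (walg_id twI) = u) in e; last exact: walg_hom_ext.
Qed.

Lemma tw_psiE (X Y : UCo) A (h : walg_hom X (Hom Y A)) x y :
  (tw_psi X Y A h : walg_hom (tw X Y) A) (odot x y) = (h x : walg_hom Y A) y.
Proof. by rewrite -tw_phiE tw_psiK. Qed.

Lemma twI_psiE A (a : A) : (twI_psi A a : walg_hom twI A) iI = a.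
Proof. by rewrite -twI_phiE twI_psiK. Qed.

Lemma tw_ext (X Y : UCo) A (u v : walg_hom (tw X Y) A) :
  (forall x y, u (odot x y) = v (odot x y)) -> u = v.
Proof.
move=> e; rewrite -[u]tw_phiK -[v]tw_phiK; congr (wh_fun (tw_psi X Y A) _).
by apply: walg_hom_ext => x; apply: walg_hom_ext => y; rewrite !tw_phiE.
Qed.

Lemma twI_ext A (u v : walg_hom twI A) : u iI = v iI -> u = v.
Proof. by move=> e; rewrite -[u]twI_phiK -[v]twI_phiK !twI_phiE e. Qed.

Lemma tw_ext_at (X Y : UCo) A (u v : walg_hom (tw X Y) A) x :
  (tw_phi X Y A u : walg_hom X (Hom Y A)) x = (tw_phi X Y A v : walg_hom X (Hom Y A)) x ->
  forall y, u (odot x y) = v (odot x y).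
Proof. by move=> e y; rewrite -!tw_phiE e. Qed.

Lemma tw_extl (X Y Z : UCo) A (u v : walg_hom (tw (tw X Y) Z) A) :
  (forall x y z, u (odot (odot x y) z) = v (odot (odot x y) z)) -> u = v.
Proof.
move=> e; apply: tw_ext => t z; apply: tw_ext_at.
apply: (congr1 (fun f : walg_hom (tw X Y) (Hom Z A) => f t)); apply: tw_ext => x y.
by apply: walg_hom_ext => c; rewrite !tw_phiE.
Qed.

Lemma tw_extr (X Y Z : UCo) A (u v : walg_hom (tw X (tw Y Z)) A) :
  (forall x y z, u (odot x (odot y z)) = v (odot x (odot y z))) -> u = v.
Proof.
move=> e; apply: tw_ext => x; apply: tw_ext_at; apply: tw_ext => y z.
by rewrite !tw_phiE.
Qed.

Lemma tw_extll (X Y Z Z' : UCo) A (u v : walg_hom (tw (tw (tw X Y) Z) Z') A) :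
  (forall x y z z', u (odot (odot (odot x y) z) z') = v (odot (odot (odot x y) z) z')) ->
  u = v.
Proof.
move=> e; apply: tw_ext => t z; apply: tw_ext_at.
apply: (congr1 (fun f : walg_hom (tw (tw X Y) Z) (Hom Z' A) => f t)).
by apply: tw_extl => x y z'; apply: walg_hom_ext => c; rewrite !tw_phiE.
Qed.

Lemma twI_extl (X : UCo) A (u v : walg_hom (tw twI X) A) :
  (forall x, u (odot iI x) = v (odot iI x)) -> u = v.
Proof.
move=> e; apply: tw_ext => t z; apply: tw_ext_at.
apply: (congr1 (fun f : walg_hom twI (Hom X A) => f t)).
by apply: twI_ext; apply: walg_hom_ext => c; rewrite !tw_phiE.
Qed.

Lemma twI_extr (X : UCo) A (u v : walg_hom (tw X twI) A) :
  (forall x, u (odot x iI) = v (odot x iI)) -> u = v.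
Proof.
by move=> e; apply: tw_ext => x; apply: tw_ext_at; apply: twI_ext; rewrite !tw_phiE.
Qed.

Lemma twI_extlr (X Y : UCo) A (u v : walg_hom (tw (tw X twI) Y) A) :
  (forall x y, u (odot (odot x iI) y) = v (odot (odot x iI) y)) -> u = v.
Proof.
move=> e; apply: tw_ext => t z; apply: tw_ext_at.
apply: (congr1 (fun f : walg_hom (tw X twI) (Hom Y A) => f t)).
by apply: twI_extr => x; apply: walg_hom_ext => c; rewrite !tw_phiE.
Qed.

Section Yoneda.
Variables (X Y : UCo) (th : forall A, walg_hom (Hom Y A) (Hom X A)).
Hypothesis th_nat : forall A B (g : walg_hom A B) (u : walg_hom Y A),
  th B (walg_cmp g u) = walg_cmp g (th A u : walg_hom X A) :> walg_hom X B.

Lemma yo_hom A (u : walg_hom Y A) :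
  th A u = walg_cmp u (th Y (walg_id Y) : walg_hom X Y) :> walg_hom X A.
Proof. by rewrite -th_nat; congr (wh_fun (th A) _); apply: walg_hom_ext. Qed.

Definition yo : coalg_hom X Y := @CoAlgHom X Y (th Y (walg_id Y))
  (fun A => @eq_is_whom T sym W (Hom Y A) (Hom X A) (th A)
    (fun u : walg_hom Y A => walg_cmp u (th Y (walg_id Y) : walg_hom X Y))
    (@yo_hom A) (wh_hom (th A))).

Lemma yoE A (u : walg_hom Y A) x : u (yo x) = (th A u : walg_hom X A) x.
Proof. by rewrite yo_hom. Qed.
End Yoneda.

Lemma tw_nat (X Y : UCo) A B (g : walg_hom A B) (u : walg_hom (tw X Y) A) :
  tw_phi X Y B (walg_cmp g u) =
  walg_cmp (fmap (HomF Y) g : walg_hom (Hom Y A) (Hom Y B)) (tw_phi X Y A u : walg_hom _ _)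
  :> walg_hom X (Hom Y B).
Proof.
by apply: walg_hom_ext => x; apply: walg_hom_ext => y; rewrite tw_phiE /= tw_phiE.
Qed.

Lemma tw_map_ex (X X' Y Y' : UCo) (f : coalg_hom X X') (g : coalg_hom Y Y') :
  exists h : coalg_hom (tw X Y) (tw X' Y'),
    forall x y, h (odot x y) = odot (f x) (g y).
Proof.
pose th A : walg_hom (Hom (tw X' Y') A) (Hom (tw X Y) A) :=
  walg_cmp (tw_psi X Y A)
    (walg_cmp (fmap (HomF X) (pre g A : hom (Hom Y' A : U) (Hom Y A : U)) : walg_hom (Hom X (Hom Y' A)) (Hom X (Hom Y A)))
      (walg_cmp (pre f (Hom Y' A)) (tw_phi X' Y' A))).
have thE A (u : walg_hom (tw X' Y') A) x y :
    (th A u : walg_hom _ _) (odot x y) = u (odot (f x) (g y)).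
  by rewrite /= tw_psiE /= tw_phiE.
have thn A B (h : walg_hom A B) (u : walg_hom (tw X' Y') A) :
    th B (walg_cmp h u) = walg_cmp h (th A u : walg_hom _ _) :> walg_hom _ _.
  by apply: tw_ext => x y; rewrite thE /= -thE.
exists (yo thn) => x y; exact: (thE _ (walg_id _)).
Qed.

Definition tw_map (X X' Y Y' : UCo) (f : hom X X') (g : hom Y Y') : hom (tw X Y) (tw X' Y') :=
  sval (cid (tw_map_ex f g)).

Lemma tw_mapE (X X' Y Y' : UCo) (f : hom X X') (g : hom Y Y') x y :
  ch (tw_map f g) (odot x y) = odot (ch f x) (ch g y).
Proof. exact: (svalP (cid (tw_map_ex f g))). Qed.

Lemma tw_assoc_ex (X Y Z : UCo) : exists h : coalg_hom (tw (tw X Y) Z) (tw X (tw Y Z)),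
  forall x y z, h (odot (odot x y) z) = odot x (odot y z).
Proof.
pose th A : walg_hom (Hom (tw X (tw Y Z)) A) (Hom (tw (tw X Y) Z) A) :=
  walg_cmp (tw_psi (tw X Y) Z A) (walg_cmp (tw_psi X Y (Hom Z A))
    (walg_cmp (fmap (HomF X) (tw_phi Y Z A : hom (Hom (tw Y Z) A : U) (Hom Y (Hom Z A) : U)) :
       walg_hom (Hom X (Hom (tw Y Z) A)) (Hom X (Hom Y (Hom Z A))))
      (tw_phi X (tw Y Z) A))).
have thE A (u : walg_hom (tw X (tw Y Z)) A) x y z :
    (th A u : walg_hom _ _) (odot (odot x y) z) = u (odot x (odot y z)).
  by rewrite /= tw_psiE tw_psiE /= tw_phiE tw_phiE.
have thn A B (h : walg_hom A B) (u : walg_hom (tw X (tw Y Z)) A) :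
    th B (walg_cmp h u) = walg_cmp h (th A u : walg_hom _ _) :> walg_hom _ _.
  by apply: tw_extl => x y z; rewrite thE /= -thE.
exists (yo thn) => x y z; exact: (thE _ (walg_id _)).
Qed.

Lemma tw_assoc'_ex (X Y Z : UCo) : exists h : coalg_hom (tw X (tw Y Z)) (tw (tw X Y) Z),
  forall x y z, h (odot x (odot y z)) = odot (odot x y) z.
Proof.
pose th A : walg_hom (Hom (tw (tw X Y) Z) A) (Hom (tw X (tw Y Z)) A) :=
  walg_cmp (tw_psi X (tw Y Z) A)
    (walg_cmp (fmap (HomF X) (tw_psi Y Z A : hom (Hom Y (Hom Z A) : U) (Hom (tw Y Z) A : U)) :
       walg_hom (Hom X (Hom Y (Hom Z A))) (Hom X (Hom (tw Y Z) A)))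
      (walg_cmp (tw_phi X Y (Hom Z A)) (tw_phi (tw X Y) Z A))).
have thE A (u : walg_hom (tw (tw X Y) Z) A) x y z :
    (th A u : walg_hom _ _) (odot x (odot y z)) = u (odot (odot x y) z).
  by rewrite /= tw_psiE /= tw_psiE tw_phiE tw_phiE.
have thn A B (h : walg_hom A B) (u : walg_hom (tw (tw X Y) Z) A) :
    th B (walg_cmp h u) = walg_cmp h (th A u : walg_hom _ _) :> walg_hom _ _.
  by apply: tw_extr => x y z; rewrite thE /= -thE.
exists (yo thn) => x y z; exact: (thE _ (walg_id _)).
Qed.

Definition tw_assoc (X Y Z : UCo) : hom (tw (tw X Y) Z) (tw X (tw Y Z)) :=
  sval (cid (tw_assoc_ex X Y Z)).

Lemma tw_assocE (X Y Z : UCo) x y z :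
  ch (tw_assoc X Y Z) (odot (odot x y) z) = odot x (odot y z).
Proof. exact: (svalP (cid (tw_assoc_ex X Y Z))). Qed.

Lemma tw_lunit_ex (X : UCo) : exists h : coalg_hom (tw twI X) X, forall x, h (odot iI x) = x.
Proof.
pose th A : walg_hom (Hom X A) (Hom (tw twI X) A) :=
  walg_cmp (tw_psi twI X A) (twI_psi (Hom X A)).
have thE A (u : walg_hom X A) x : (th A u : walg_hom _ _) (odot iI x) = u x.
  by rewrite /= tw_psiE twI_psiE.
have thn A B (h : walg_hom A B) (u : walg_hom X A) :
    th B (walg_cmp h u) = walg_cmp h (th A u : walg_hom _ _) :> walg_hom _ _.
  by apply: twI_extl => x; rewrite thE /= -thE.
exists (yo thn) => x; exact: (thE _ (walg_id _)).
Qed.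

Lemma tw_lunit'_ex (X : UCo) : exists h : coalg_hom X (tw twI X), forall x, h x = odot iI x.
Proof.
pose th A : walg_hom (Hom (tw twI X) A) (Hom X A) :=
  walg_cmp (twI_phi (Hom X A)) (tw_phi twI X A).
have thE A (u : walg_hom (tw twI X) A) x : (th A u : walg_hom _ _) x = u (odot iI x).
  by rewrite /= twI_phiE tw_phiE.
have thn A B (h : walg_hom A B) (u : walg_hom (tw twI X) A) :
    th B (walg_cmp h u) = walg_cmp h (th A u : walg_hom _ _) :> walg_hom _ _.
  by apply: walg_hom_ext => x; rewrite thE /= -thE.
exists (yo thn) => x; exact: (thE _ (walg_id _)).
Qed.

Lemma tw_runit_ex (X : UCo) : exists h : coalg_hom (tw X twI) X, forall x, h (odot x iI) = x.
Proof.
pose th A : walg_hom (Hom X A) (Hom (tw X twI) A) :=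
  walg_cmp (tw_psi X twI A)
    (fmap (HomF X) (twI_psi A : hom (A : U) (Hom twI A : U)) :
      walg_hom (Hom X A) (Hom X (Hom twI A))).
have thE A (u : walg_hom X A) x : (th A u : walg_hom _ _) (odot x iI) = u x.
  by rewrite /= tw_psiE /= twI_psiE.
have thn A B (h : walg_hom A B) (u : walg_hom X A) :
    th B (walg_cmp h u) = walg_cmp h (th A u : walg_hom _ _) :> walg_hom _ _.
  by apply: twI_extr => x; rewrite thE /= -thE.
exists (yo thn) => x; exact: (thE _ (walg_id _)).
Qed.

Lemma tw_runit'_ex (X : UCo) : exists h : coalg_hom X (tw X twI), forall x, h x = odot x iI.
Proof.
pose th A : walg_hom (Hom (tw X twI) A) (Hom X A) :=
  walg_cmp (fmap (HomF X) (twI_phi A : hom (Hom twI A : U) (A : U)) :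
      walg_hom (Hom X (Hom twI A)) (Hom X A)) (tw_phi X twI A).
have thE A (u : walg_hom (tw X twI) A) x : (th A u : walg_hom _ _) x = u (odot x iI).
  by rewrite /= twI_phiE tw_phiE.
have thn A B (h : walg_hom A B) (u : walg_hom (tw X twI) A) :
    th B (walg_cmp h u) = walg_cmp h (th A u : walg_hom _ _) :> walg_hom _ _.
  by apply: walg_hom_ext => x; rewrite thE /= -thE.
exists (yo thn) => x; exact: (thE _ (walg_id _)).
Qed.

Definition tw_lunit (X : UCo) : hom (tw twI X) X := sval (cid (tw_lunit_ex X)).
Definition tw_runit (X : UCo) : hom (tw X twI) X := sval (cid (tw_runit_ex X)).

Lemma tw_lunitE (X : UCo) x : ch (tw_lunit X) (odot iI x) = x.
Proof. exact: (svalP (cid (tw_lunit_ex X))). Qed.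

Lemma tw_runitE (X : UCo) x : ch (tw_runit X) (odot x iI) = x.
Proof. exact: (svalP (cid (tw_runit_ex X))). Qed.

Lemma coalg_hom_eq (X Y : UCo) (f g : coalg_hom X Y) : ch f = ch g -> f = g.
Proof. by move=> e; apply: coalg_hom_ext => x; rewrite e. Qed.

(* The structure maps are those induced through the defining isomorphisms
   [tw_iso] and [twI_iso]. *)
Program Definition MUCo : monoidal UCo :=
  @Monoidal UCo tw tw_map _ _ twI tw_assoc tw_lunit tw_runit _ _ _ _ _ _ _ _.
Next Obligation.
by move=> X Y; apply: coalg_hom_eq; apply: tw_ext => x y; rewrite tw_mapE.
Qed.
Next Obligation.
by move=> *; apply: coalg_hom_eq; apply: tw_ext => x y; rewrite /= !tw_mapE.
Qed.
Next Obligation.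
move=> X Y Z; have [h hE] := tw_assoc'_ex X Y Z; exists h; split; apply: coalg_hom_eq.
- by apply: tw_extl => x y z; rewrite /= tw_assocE hE.
- by apply: tw_extr => x y z; rewrite /= hE tw_assocE.
Qed.
Next Obligation.
move=> X; have [h hE] := tw_lunit'_ex X; exists h; split; apply: coalg_hom_eq.
- by apply: twI_extl => x; rewrite /= tw_lunitE hE.
- by apply: walg_hom_ext => x; rewrite /= hE tw_lunitE.
Qed.
Next Obligation.
move=> X; have [h hE] := tw_runit'_ex X; exists h; split; apply: coalg_hom_eq.
- by apply: twI_extr => x; rewrite /= tw_runitE hE.
- by apply: walg_hom_ext => x; rewrite /= hE tw_runitE.
Qed.
Next Obligation.
move=> *; apply: coalg_hom_eq; apply: tw_extl => x y z.
by rewrite /= !(tw_mapE, tw_assocE).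
Qed.
Next Obligation.
by move=> *; apply: coalg_hom_eq; apply: twI_extl => x; rewrite /= !(tw_mapE, tw_lunitE).
Qed.
Next Obligation.
by move=> *; apply: coalg_hom_eq; apply: twI_extr => x; rewrite /= !(tw_mapE, tw_runitE).
Qed.
Next Obligation.
by move=> *; apply: coalg_hom_eq; apply: tw_extll => x y z z'; rewrite /= !(tw_mapE, tw_assocE).
Qed.
Next Obligation.
move=> *; apply: coalg_hom_eq; apply: twI_extlr => x y.
by rewrite /= !(tw_mapE, tw_assocE, tw_lunitE, tw_runitE).
Qed.

End CoAlgebras.

(* Main.v *)
From mathcomp Require Import all_boot order perm.
From mathcomp Require Import boolp.
Require Import Defs.

(* For a comonoid [K] and a [U]-algebra [A], the object [Hom_V(K, A)] is a
   [U]-algebra under convolution: [w] sends [f_1, ..., f_n] to the composite of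
   the iterated comultiplication [K -> K (x) ... (x) K], of [f_1 (x) ... (x) f_n] and of the
   action of [w] on [A]. The bijection [Hom_U(F_{U,V} K, A) ~ Hom_V(K, A)]
   transports this structure to a co-[U]-algebra structure on [F_{U,V} K].
   Currying [Hom_V(K (x) L, A) ~ Hom_V(K, Hom_V(L, A))] respects convolution, as
   the comultiplication of [K (x) L] is computed factorwise; by the Yoneda lemma
   this gives the comparison with the Tall-Wraith product. Convolution operations
   are pointwise on group-like elements, which include the generators of [F_V X]
   and of the unit. *)

Set Implicit Arguments.
Unset Strict Implicit.
Unset Printing Implicit Defensive.

(** * Maps between tensor powers, and their concatenation *)

Section TensorPowers.
Variable T : comm_theory.
Implicit Types A B : alg T.

Fixpoint tpowm A B n : ('I_n -> alg_hom A B) -> alg_hom (tpow A n) (tpow B n) :=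
  match n with
  | 0 => fun=> alg_id (tenunit T)
  | n'.+1 => fun f => tenm (f ord0) (tpowm (fun i => f (lift ord0 i)))
  end.

Lemma tpowmE A B n (f : 'I_n -> alg_hom A B) x :
  tpowm f (ptens x) = ptens (fun i => f i (x i)).
Proof. by elim: n f x => //= n ih f x; rewrite tenmE ih. Qed.

Lemma tpowm_comp A B C n (g : 'I_n -> alg_hom B C) (f : 'I_n -> alg_hom A B) t :
  tpowm g (tpowm f t) = tpowm (fun i => alg_cmp (g i) (f i)) t.
Proof.
suff /alg_hom_app /(_ t) : alg_cmp (tpowm g) (tpowm f) = tpowm (fun i => alg_cmp (g i) (f i)) by [].
by apply: tpow_ext => x; rewrite /= !tpowmE.
Qed.

Fixpoint tcat A m p : alg_hom (ten (tpow A m) (tpow A p)) (tpow A (m + p)) :=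
  match m with
  | 0 => ten_lunit _
  | m'.+1 => alg_cmp (tenm (alg_id A) (tcat A m' p)) (ten_assoc _ _ _)
  end.

Lemma tcatE A m p (x : 'I_(m + p) -> A) :
  tcat A m p (pure (ptens (fun i => x (lshift p i))) (ptens (fun i => x (rshift m i)))) =
  ptens x.
Proof.
elim: m x => [|m ih] x /=.
  by rewrite ten_lunitE; congr ptens; apply: funext => i; congr x; apply: val_inj.
rewrite ten_assocE tenmE /=; congr pure; first by congr x; apply: val_inj.
rewrite -ih; congr (tcat _ _ _ (pure (ptens _) (ptens _))); apply: funext => i;
  by congr x; apply: val_inj.
Qed.

(** The blocks of an operadic composite have varying lengths [n i], so their tensor product is not a
    tensor power. It is nested to the right and ends in the unit, like [tpow], so that both follow
    the same recursion on [k]. *)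
Fixpoint hten A k : ('I_k -> nat) -> alg T :=
  match k with
  | 0 => fun=> tenunit T
  | k'.+1 => fun n => ten (tpow A (n ord0)) (hten A (fun i => n (lift ord0 i)))
  end.

Fixpoint htens A k : forall n : 'I_k -> nat, (forall i, tpow A (n i)) -> hten A n :=
  match k with
  | 0 => fun _ _ => eta_V T tt
  | k'.+1 => fun n x => pure (x ord0) (htens (fun i => x (lift ord0 i)))
  end.

Fixpoint htenm A B k :
  forall n : 'I_k -> nat, (forall i, alg_hom (tpow A (n i)) B) -> alg_hom (hten A n) (tpow B k) :=
  match k with
  | 0 => fun _ _ => alg_id _
  | k'.+1 => fun n f => tenm (f ord0) (htenm (fun i => f (lift ord0 i)))
  end.

Lemma htenmE A B k (n : 'I_k -> nat) (f : forall i, alg_hom (tpow A (n i)) B) x :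
  htenm f (htens x) = ptens (fun i => f i (x i)).
Proof. by elim: k n f x => //= k ih n f x; rewrite tenmE ih. Qed.

End TensorPowers.

(** * Iterated comultiplication and its compatibility with grouping into blocks *)

Section IteratedComultiplication.
Variables (T : comm_theory) (sym : bool).

(** As [tpow] ends in the unit object, already [itcomul K 1] is the comultiplication followed by the
    counit on the second factor. *)
Fixpoint itcomul (K : comonoid_data (MV T)) n : alg_hom (cm_ob K) (tpow (cm_ob K) n) :=
  match n with
  | 0 => cm_unit K
  | n'.+1 => alg_cmp (tenm (alg_id _) (itcomul K n')) (cm_mul K)
  end.

Variable K : comonoid (SV T) sym.
Notation K0 := (cm_ob K : alg T).
Notation delta n := (itcomul K n).
Let dK : alg_hom K0 (ten K0 K0) := cm_mul K.
Let eK : alg_hom K0 (tenunit T) := cm_unit K.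

Lemma comulA a : ten_assoc _ _ _ (tenm dK (alg_id _) (dK a)) = tenm (alg_id _) dK (dK a).
Proof. by have /= := alg_hom_app (cm_assoc K) a. Qed.

Lemma comul1l a : ten_lunit _ (tenm eK (alg_id _) (dK a)) = a.
Proof. by have /= := alg_hom_app (cm_lunit K) a. Qed.

Lemma comul1r a : ten_runit _ (tenm (alg_id _) eK (dK a)) = a.
Proof. by have /= := alg_hom_app (cm_runit K) a. Qed.

(** Induction on [m]: the left counit law gives the case of an empty first factor, and
    coassociativity moves one factor across. *)
Lemma itcomulD m p a : delta (m + p) a = tcat K0 m p (tenm (delta m) (delta p) (dK a)).
Proof.
elim: m a => [|m ih] a.
  suff E : alg_cmp (ten_lunit _) (tenm (delta 0) (delta p)) =
      alg_cmp (delta p) (alg_cmp (ten_lunit _) (tenm eK (alg_id _))).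
    by have /= -> := alg_hom_app E (dK a); rewrite comul1l.
  apply: ten_ext => b c; rewrite /= !tenmE /=.
  suff /alg_hom_app /(_ (cm_unit K b)) : alg_cmp (ten_lunit _) (purel _ (delta p c)) =
     alg_cmp (delta p) (alg_cmp (ten_lunit _) (purel _ c)) by [].
  by apply: eta_extu; rewrite /= !ten_lunitE.
have -> : delta (m.+1 + p) a = tenm (alg_id _) (delta (m + p)) (dK a) by [].
have -> : delta (m + p) = alg_cmp (tcat K0 m p) (alg_cmp (tenm (delta m) (delta p)) dK).
  by apply: alg_hom_ext => b; rewrite ih.
pose t := tenm (alg_id K0) (tcat K0 m p).
have E1 : tenm (alg_id _) (alg_cmp (tcat K0 m p) (alg_cmp (tenm (delta m) (delta p)) dK)) =
    alg_cmp (alg_cmp t (tenm (alg_id _) (tenm (delta m) (delta p)))) (tenm (alg_id _) dK).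
  by apply: ten_ext => b c; rewrite /= !tenmE.
have E2 : alg_cmp (tcat K0 m.+1 p) (tenm (delta m.+1) (delta p)) =
    alg_cmp (alg_cmp t (tenm (alg_id _) (tenm (delta m) (delta p))))
      (alg_cmp (ten_assoc _ _ _) (tenm dK (alg_id _))).
  apply: ten_ext => b c; rewrite /= !tenmE /=.
  have E3 : alg_cmp (ten_assoc _ _ _) (alg_cmp (purel _ (delta p c)) (tenm (alg_id K0) (delta m))) =
      alg_cmp (tenm (alg_id _) (tenm (delta m) (delta p))) (alg_cmp (ten_assoc _ _ _) (purel _ c)).
    by apply: ten_ext => d e; rewrite /= !tenmE !ten_assocE !tenmE.
  by have /= -> := alg_hom_app E3 (dK b).
have /= -> := alg_hom_app E1 (dK a); have /= -> := alg_hom_app E2 (dK a).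
by rewrite comulA.
Qed.

(* [r i j] is the position of the [j]-th element of the [i]-th block; [G] is [h]
   with its arguments grouped into blocks, and [g] is [G] after comultiplying
   within each block. *)
Lemma itcomul_blocks k (n : 'I_k -> nat) N (r : forall i, 'I_(n i) -> 'I_N) B
    (h : alg_hom (tpow K0 N) B) (G : alg_hom (hten K0 n) B) (g : alg_hom (tpow K0 k) B) :
  N = \sum_i n i ->
  (forall i j, r i j = \sum_(i' < k | i' < i) n i' + j :> nat) ->
  (forall x, G (htens (fun i => ptens (fun j => x (r i j)))) = h (ptens x)) ->
  (forall a, g (ptens a) = G (htens (fun i => delta (n i) (a i)))) ->
  forall a, h (delta N a) = g (delta k a).
Proof.
elim: k n N r h G g => [|k ih] n N r h G g eN rE Gh gG a.
  rewrite big_ord0 in eN; subst N; have x0 : 'I_0 -> K0 by case.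
  suff -> : h = g by [].
  by apply: eta_extu; rewrite [RHS](gG x0) -[LHS](Gh x0).
rewrite big_ord_recl in eN; set N' := \sum_i _ in eN; subst N.
(* The first block is split off from the remaining [N'] factors. *)
rewrite itcomulD /=.
suff /alg_hom_app /(_ (dK a)) :
  alg_cmp h (alg_cmp (tcat _ _ _) (tenm (delta (n ord0)) (delta N'))) =
  alg_cmp g (tenm (alg_id _) (delta k)) by [].
apply: ten_ext => b c; rewrite /= !tenmE /=.
pose n' i := n (lift ord0 i).
have r0 j : r ord0 j = lshift N' j.
  by apply: val_inj; rewrite /= rE big_pred0.
have lt_r i (j : 'I_(n' i)) : \sum_(i' < k | i' < i) n' i' + j < N'.
  by rewrite -(tagnat.RankEsum (p_ := n')) ltn_ord.
pose r' i (j : 'I_(n' i)) : 'I_N' := Ordinal (lt_r i j).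
have rS i j : r (lift ord0 i) j = rshift (n ord0) (r' i j).
  apply: val_inj; rewrite /= rE addnA; congr (_ + _).
  by rewrite big_mkcond big_ord_recl -big_mkcond.
(* The first argument is fixed: [b] for [g], its comultiplied block for [h] and [G]. The induction
   hypothesis handles the other blocks. *)
pose h' := alg_cmp h (alg_cmp (tcat K0 (n ord0) N') (purer _ (delta (n ord0) b))).
pose G' := alg_cmp G (purer (hten K0 n') (delta (n ord0) b)).
pose g' := alg_cmp g (purer (tpow K0 k) b).
apply: (ih n' N' r' h' G' g') => //.
  move=> x; rewrite /h' /G' /=.
  (* [delta (n ord0) b] need not be a pure tensor, so the equation is proved for every element of
     that tensor power, where pure tensors [ptens z] suffice. *)
  suff /alg_hom_app /(_ (delta (n ord0) b)) : alg_cmp G (purel _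
     (htens (fun i => ptens (fun j => x (r' i j))))) =
     alg_cmp h (alg_cmp (tcat K0 (n ord0) N') (purel _ (ptens x))) by [].
  apply: tpow_ext => z.
  (* [y] concatenates [z] and [x], which brings the goal into the form of [Gh]. *)
  pose y t := match split t with inl i => z i | inr j => x j end.
  have yl i : y (lshift N' i) = z i by rewrite /y (unsplitK (inl _ i)).
  have yr i : y (rshift (n ord0) i) = x i by rewrite /y (unsplitK (inr _ i)).
  have := Gh y; rewrite -tcatE /=.
  have -> : (fun i => y (lshift N' i)) = z by apply: funext.
  have -> : (fun i => y (rshift (n ord0) i)) = x by apply: funext.
  move=> <-; congr (G (pure _ _)).
    by congr ptens; apply: funext => j; rewrite r0 yl.
  congr htens; apply: functional_extensionality_dep => i; congr ptens; apply: funext => j.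
  by rewrite rS yr.
move=> z; rewrite /g' /G' /= -ptens_cons gG /= fcons0; congr (G (pure _ _)).
by congr htens; apply: functional_extensionality_dep => i; rewrite fconsS.
Qed.

End IteratedComultiplication.

(** * Invariance of iterated comultiplication under permutations *)

Section Cocommutativity.
Variables (T : comm_theory) (sym : bool).

Lemma tpow_permP (A : alg T) n (s : 'I_n -> 'I_n) : injective s ->
  exists p : alg_hom (tpow A n) (tpow A n), forall x, p (ptens x) = ptens (fun i => x (s i)).
Proof.
move=> s_inj; have [s' _ s'K] := injF_bij s_inj.
apply: (@tpow_lift T A (tpow A n) n (fun x => ptens (fun i => x (s i)))).
(* Multilinearity survives the permutation because changing [x] at [i] changes the permuted family
   only at the preimage [s' i]. *)
have updE (x : 'I_n -> A) i z :
    (fun j => upd x i z (s j)) = upd (fun j => x (s j)) (s' i) z.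
  by apply: funext => j; rewrite /upd -(inj_eq s_inj j) s'K.
move=> x i m p o y j; rewrite updE ptens_multi; congr aop.
by apply: funext => k; rewrite updE.
Qed.

Variable K : comonoid (SV T) sym.
Hypothesis comulC : forall a, ten_swap (cm_ob K) (cm_ob K) (cm_mul K a) = cm_mul K a.
Notation K0 := (cm_ob K : alg T).
Notation delta n := (itcomul K n).

(** By induction the argument [j] is first moved to the front of the tail; an exchange of the first
    two factors, harmless by cocommutativity, then brings it to the very front. *)
Lemma itcomul_front n (j : 'I_n.+1) B (h g : alg_hom (tpow K0 n.+1) B) :
  (forall x, h (ptens x) = g (ptens (fcons (x j) (fun i => x (lift j i))))) ->
  forall a, h (delta n.+1 a) = g (delta n.+1 a).
Proof.
elim: n j h g => [|n ih] j h g hg a; case: (unliftP ord0 j) => [j'|] jE; subst j.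
- by case: j' hg.
- suff -> : h = g by []; apply: tpow_ext => x; rewrite hg.
  by rewrite fcons_eta.
(* [t] exchanges the first two factors. *)
- have [t tE] : exists t : alg_hom (ten K0 (ten K0 (tpow K0 n))) (ten K0 (ten K0 (tpow K0 n))),
      forall b c d, t (pure b (pure c d)) = pure c (pure b d).
    by apply: trihomP' => [b c|b c|b c] m p o y k; rewrite ?pure_homr ?pure_homl ?pure_homr.
  have -> : h (delta n.+2 a) = g (t (delta n.+2 a)).
    suff /alg_hom_app /(_ (cm_mul K a)) : alg_cmp h (tenm (alg_id _) (delta n.+1)) =
      alg_cmp g (alg_cmp t (tenm (alg_id _) (delta n.+1))) by [].
    apply: ten_ext => b c; rewrite /= !tenmE /=.
    apply: (ih j' (alg_cmp h (purer _ b)) (alg_cmp g (alg_cmp t (purer _ b)))) => x.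
    rewrite -[LHS]/(h (pure b (ptens x))) -ptens_cons hg /= tE !fcons0 fconsS.
    congr (g (pure _ (pure _ (ptens _)))).
      by rewrite fconsS (_ : lift (lift ord0 j') ord0 = ord0) ?fcons0 //; apply: val_inj.
    apply: funext => i; rewrite !fconsS -[RHS](fconsS b); congr fcons.
    by apply: val_inj; rewrite /= /bump /= !add1n ltnS addnS.
  (* It remains that [t] fixes the iterated comultiplication. By coassociativity its first two
     factors can be taken to arise from a single comultiplication, which the swap fixes. *)
  suff E : alg_cmp t (alg_cmp (tenm (alg_id _) (tenm (alg_id _) (delta n))) (ten_assoc _ _ _)) =
      alg_cmp (tenm (alg_id _) (tenm (alg_id _) (delta n)))
        (alg_cmp (ten_assoc _ _ _) (tenm (ten_swap K0 K0) (alg_id K0))).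
    have -> : delta n.+2 a = tenm (alg_id _) (tenm (alg_id _) (delta n))
        (ten_assoc _ _ _ (tenm (cm_mul K) (alg_id _) (cm_mul K a))).
      rewrite comulA /=.
      suff /alg_hom_app /(_ (cm_mul K a)) : tenm (alg_id _) (delta n.+1) =
        alg_cmp (tenm (alg_id K0) (tenm (alg_id K0) (delta n))) (tenm (alg_id _) (cm_mul K)) by [].
      by apply: ten_ext => b c; rewrite /= !tenmE.
    have /= -> := alg_hom_app E (tenm (cm_mul K) (alg_id _) (cm_mul K a)).
    congr (g (tenm _ _ (ten_assoc _ _ _ _))).
    suff /alg_hom_app /(_ (cm_mul K a)) : alg_cmp (tenm (ten_swap K0 K0) (alg_id K0))
        (tenm (cm_mul K) (alg_id K0)) = tenm (cm_mul K) (alg_id K0) by [].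
    by apply: ten_ext => b c; rewrite /= !tenmE comulC.
  by apply: ten3l_ext => b c d; rewrite /= ?(tenmE, ten_assocE, ten_swapE) tE.
- by suff -> : h = g by []; apply: tpow_ext => x; rewrite hg fcons_eta.
Qed.

(* A permutation moves one argument to the front and permutes the others. *)
Lemma itcomul_perm n (s : 'I_n -> 'I_n) B (h g : alg_hom (tpow K0 n) B) : injective s ->
  (forall x, h (ptens x) = g (ptens (fun i => x (s i)))) ->
  forall a, h (delta n a) = g (delta n a).
Proof.
elim: n s h g => [|n ih] s h g s_inj hg a.
  suff -> : h = g by []; apply: tpow_ext => x; rewrite hg; congr (g (ptens _)).
  by apply: funext => -[].
(* [s'] is the permutation left on the tail once the value [s ord0] is deleted. The default never
   occurs, as [s] is injective. *)
pose s' i := odflt i (unlift (s ord0) (s (lift ord0 i))).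
have s'E i : s (lift ord0 i) = lift (s ord0) (s' i).
  rewrite /s'; case: unliftP => [i' //|] /s_inj e.
  by have := neq_lift ord0 i; rewrite e eqxx.
have s'_inj : injective s'.
  by move=> i i' e; apply: (@lift_inj _ ord0); apply: s_inj; rewrite !s'E e.
have [p pE] := tpow_permP K0 s'_inj.
(* Argument [s ord0] goes to the front; the residual permutation [p] of the tail is absorbed by the
   induction hypothesis. *)
have -> : h (delta n.+1 a) = g (tenm (alg_id _) p (delta n.+1 a)).
  apply: (@itcomul_front n (s ord0) _ h (alg_cmp g (tenm (alg_id _) p))) => x.
  rewrite hg /= tenmE pE fcons0 /=; congr (g (pure _ (ptens _))).
  by apply: funext => i; rewrite s'E fconsS.
suff /alg_hom_app /(_ (cm_mul K a)) :
  alg_cmp g (alg_cmp (tenm (alg_id _) p) (tenm (alg_id _) (delta n))) =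
    alg_cmp g (tenm (alg_id _) (delta n)) by [].
apply: ten_ext => b c; rewrite /= !tenmE /=.
apply: (ih s' (alg_cmp g (alg_cmp (purer _ b) p)) (alg_cmp g (purer _ b))) => // x.
by rewrite /= pE.
Qed.

End Cocommutativity.

(** * The convolution algebra and its functoriality *)

Section Convolution.
Variables (T : comm_theory) (sym : bool) (W : operad sym).
Local Notation U := (UAlg T W).
Local Notation walg := (walg T W).
Local Notation Comon := (Comon (SV T) sym).
Implicit Types A B : walg.

Lemma walg_aop_hom A B (g : walg_hom A B) n m (o : T n m) x j :
  g (@aop T (walg_alg A) _ _ o x j) = @aop T (walg_alg B) _ _ o (fun k => g (x k)) j.
Proof. exact: (proj1 (wh_hom g)). Qed.

Lemma walg_wop_hom A B (g : walg_hom A B) n (w : W n) x :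
  g (wop w x) = wop w (fun k => g (x k)).
Proof. exact: (proj2 (wh_hom g)). Qed.

Definition convop (K : Comon) A n (w : W n) (f : 'I_n -> alg_hom (cm_ob K) (walg_alg A)) :
  alg_hom (cm_ob K) (walg_alg A) :=
  alg_cmp (wact (walg_str A) w) (alg_cmp (tpowm f) (itcomul K n)).

Section ConvolutionAlgebra.
Variables (K : Comon) (A : walg).
Notation K0 := (cm_ob K : alg T).
Notation A0 := (walg_alg A).

Lemma convop_multi n (w : W n) : @multihom T (ihom K0 A0) (ihom K0 A0) n (@convop K A n w).
Proof.
move=> f i m p o h j; apply: alg_hom_ext => a; rewrite ihom_opE /=.
(* The equation holds on the whole tensor power, not only on comultiplied elements; on pure tensors
   it is the multilinearity of [w] in [A]. *)
suff /alg_hom_app /(_ (itcomul K n a)) :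
  alg_cmp (wact (walg_str A) w) (tpowm (upd f i (aop o h j : ihom K0 A0))) =
  (aop o (fun k => alg_cmp (wact (walg_str A) w) (tpowm (upd f i (h k))) : ihom _ _) j :
    ihom (tpow K0 n) A0) by [].
have updE (g : ihom K0 A0) x :
    (fun i' => (upd f i g i' : alg_hom K0 A0) (x i')) =
    upd (fun i' => (f i' : alg_hom _ _) (x i')) i ((g : alg_hom _ _) (x i)).
  by apply: funext => i'; rewrite /upd; case: eqP => [->|].
apply: tpow_ext => x; rewrite ihom_opE /= tpowmE updE ihom_opE -/(wop w _) wop_multiE.
by apply: (congr1 (fun z => @aop T A0 _ _ o z j)); apply: funext => k /=; rewrite tpowmE updE.
Qed.

(** The counit inside [itcomul K 1] cancels by the right counit law. *)
Lemma convop_one (f : 'I_1 -> ihom K0 A0) : convop (op_one W) f = f ord0.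
Proof.
apply: alg_hom_ext => a; rewrite -[in RHS](comul1r a) /=.
suff E : alg_cmp (wact (walg_str A) (op_one W)) (tpowm f) =
    alg_cmp (f ord0 : alg_hom K0 A0) (ten_runit _).
  have /= -> := alg_hom_app E (tenm (alg_id _) (cm_unit K) (cm_mul K a)).
  by [].
apply: tenr_ext => b /=; rewrite ten_runitE.
rewrite -[pure b _]/(@ptens T K0 1 (fun=> b)) -[RHS](wop_one (fun=> f ord0 b)).
rewrite -[tenm _ _ _]/(tpowm f (@ptens T K0 1 (fun=> b))) tpowmE.
by congr (wact _ _ (ptens _)); apply: funext => i; rewrite (ord1 i).
Qed.

Lemma convop_comp k (w : W k) (n : 'I_k -> nat) (v : forall i, W (n i))
    (f : 'I_(\sum_i n i) -> ihom K0 A0) :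
  convop (op_comp w v) f =
  convop w (fun i => convop (v i) (fun j => f (@tagnat.Rank k n i j))).
Proof.
apply: alg_hom_ext => a.
(* [m i] is the convolution for block [i] before its comultiplication, so that [itcomul_blocks]
   applies with [G] built from the [m i]. *)
pose m i := alg_cmp (wact (walg_str A) (v i)) (tpowm (fun j => f (@tagnat.Rank k n i j))).
apply: (@itcomul_blocks _ _ K k n _ (@tagnat.Rank k n) _
  (alg_cmp (wact (walg_str A) (op_comp w v)) (tpowm f))
  (alg_cmp (wact (walg_str A) w) (htenm m))
  (alg_cmp (wact (walg_str A) w)
    (tpowm (fun i => convop (v i) (fun j => f (@tagnat.Rank k n i j)))))) => //.
- by move=> i j; rewrite tagnat.RankEsum.
- move=> x; rewrite /= tpowmE htenmE -[RHS]/(wop _ _) wop_comp.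
  by congr (wop w _); apply: funext => i; rewrite /= tpowmE.
- by move=> b; rewrite /= tpowmE htenmE.
Qed.

Lemma convop_act (h : sym) n (w : W n) (s : 'S_n) (f : 'I_n -> ihom K0 A0) :
  convop (op_act h w s) f = convop w (fun i => f (s i)).
Proof.
apply: alg_hom_ext => a.
(* A group action is present only when the flag [sym] holds, and then [K] is cocommutative. *)
have comulC b : ten_swap K0 K0 (cm_mul K b) = cm_mul K b.
  by have /= := alg_hom_app (cm_comm K h) b.
apply: (@itcomul_perm _ _ K comulC n s _
  (alg_cmp (wact (walg_str A) (op_act h w s)) (tpowm f))
  (alg_cmp (wact (walg_str A) w) (tpowm (fun i => f (s i))))); first exact: perm_inj.
by move=> x; rewrite /= !tpowmE -[LHS]/(wop _ _) wop_act.
Qed.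

Definition conv : walg := WAlg (mk_walg_on (base := alg_str (ihom K0 A0))
  convop_multi convop_one convop_comp convop_act).

Lemma conv_wopE n (w : W n) (f : 'I_n -> conv) : wop w f = convop w f.
Proof. exact: mk_wopE. Qed.

Definition grouplike (a : cm_ob K) : Prop :=
  cm_mul K a = pure a a /\ cm_unit K a = eta_V T tt.

Lemma itcomul_grouplike a : grouplike a -> forall n, itcomul K n a = ptens (fun=> a).
Proof. by case=> dE eE; elim=> [|n ih] //=; rewrite [cm_mul K a]dE tenmE ih. Qed.

Lemma conv_grouplike a : grouplike a ->
  @is_whom T sym W conv A (fun f : alg_hom K0 A0 => f a).
Proof.
move=> ga; split=> // n w f.
by rewrite conv_wopE /convop /= itcomul_grouplike // tpowmE.
Qed.

End ConvolutionAlgebra.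

(** A comonoid morphism commutes with all iterated comultiplications, and [g] commutes with the
    action of each [w]. *)
Lemma conv_map K L A B (g : walg_hom A B) (d : hom K L) :
  @is_whom T sym W (conv L A) (conv K B)
    (fun f : alg_hom (cm_ob L) (walg_alg A) =>
       alg_cmp (fmap (forget_UV T W) g : alg_hom _ _) (alg_cmp f (cmh d))).
Proof.
have dE n a : itcomul L n (cmh d a) = tpowm (fun=> cmh d) (itcomul K n a).
  elim: n a => [|n ih] a /=; first by have /= -> := alg_hom_app (cmh_unit d) a.
  have /= -> := alg_hom_app (cmh_mul d) a.
  suff /alg_hom_app /(_ (cm_mul K a)) :
    alg_cmp (tenm (alg_id _) (itcomul L n)) (tenm (cmh d) (cmh d)) =
    alg_cmp (tenm (cmh d) (tpowm (fun=> cmh d))) (tenm (alg_id _) (itcomul K n)) by [].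
  by apply: ten_ext => b c; rewrite /= !tenmE /= ih.
split=> [n m o f j|n w f]; apply: alg_hom_ext => a.
  exact: walg_aop_hom.
rewrite !conv_wopE /convop /= dE tpowm_comp.
suff /alg_hom_app /(_ (itcomul K n a)) :
  alg_cmp (fmap (forget_UV T W) g : alg_hom _ _)
    (alg_cmp (wact (walg_str A) w) (tpowm (fun i => alg_cmp (f i : alg_hom _ _) (cmh d)))) =
  alg_cmp (wact (walg_str B) w) (tpowm (fun i =>
    alg_cmp (fmap (forget_UV T W) g : alg_hom _ _) (alg_cmp (f i : alg_hom _ _) (cmh d)))) by [].
apply: tpow_ext => x; rewrite /= !tpowmE -[in LHS]/(wop _ _) -[RHS]/(wop _ _).
by rewrite walg_wop_hom.
Qed.

End Convolution.

(** * Currying of convolution algebras over a tensor product of comonoids *)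

Section ConvolutionTensor.
Variables (T : comm_theory) (sym : bool) (W : operad sym).
Local Notation walg := (walg T W).
Local Notation Comon := (Comon (SV T) sym).
Implicit Types A B : walg.

Fixpoint tzip (C D : alg T) n : alg_hom (ten (tpow C n) (tpow D n)) (tpow (ten C D) n) :=
  match n with
  | 0 => ten_lunit _
  | n'.+1 => alg_cmp (tenm (alg_id _) (tzip C D n')) (ten_mid _ _ _ _)
  end.

Lemma tzipE (C D : alg T) n (x : 'I_n -> C) (y : 'I_n -> D) :
  tzip C D n (pure (ptens x) (ptens y)) = ptens (fun i => pure (x i) (y i)).
Proof. by elim: n x y => [|n ih] x y /=; rewrite ?ten_lunitE // ten_midE tenmE ih. Qed.

Variables K L : Comon.
Notation K0 := (cm_ob K : alg T).
Notation L0 := (cm_ob L : alg T).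

(** The comultiplication of [K (x) L] ends in a middle-four interchange, and [tzip] iterates these
    interchanges. *)
Lemma itcomul_ten n (k : K0) (l : L0) :
  itcomul (comon_ten K L) n (pure k l) = tzip _ _ n (pure (itcomul K n k) (itcomul L n l)).
Proof.
elim: n k l => [|n ih] k l /=; rewrite tenmE //.
suff /alg_hom_app /(_ (pure (cm_mul K k) (cm_mul L l))) :
  alg_cmp (tenm (alg_id _) (itcomul (comon_ten K L) n)) (ten_mid _ _ _ _) =
  alg_cmp (alg_cmp (tenm (alg_id _) (tzip _ _ n)) (ten_mid _ _ _ _))
    (tenm (tenm (alg_id K0) (itcomul K n)) (tenm (alg_id L0) (itcomul L n))).
  by rewrite /= !tenmE.
by apply: ten4_ext => a b c d; rewrite /= !(tenmE, ten_midE) /= ih.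
Qed.

Variable A : walg.

Lemma curry_hom (f : alg_hom (ten K0 L0) (walg_alg A)) :
  @is_hom T K0 (walg_alg (conv L A)) (fun k => alg_cmp f (purer L0 k)).
Proof.
move=> n m o x j; apply: alg_hom_ext => l.
exact: (ah_hom (alg_cmp f (purel K0 l))).
Qed.

Definition curry (f : conv (comon_ten K L) A) : conv K (conv L A) := AlgHom (curry_hom f).

Lemma curryE (f : conv (comon_ten K L) A) k l :
  (((curry f : alg_hom K0 (walg_alg (conv L A))) k) : alg_hom L0 (walg_alg A)) l =
  (f : alg_hom (ten K0 L0) (walg_alg A)) (pure k l).
Proof. by []. Qed.

Lemma curry_whom : @is_whom T sym W (conv (comon_ten K L) A) (conv K (conv L A)) curry.
Proof.
split=> [n m o f j|n w f]; first by apply: alg_hom_ext => k; apply: alg_hom_ext.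
apply: alg_hom_ext => k; apply: alg_hom_ext => l.
rewrite !conv_wopE curryE /convop /= itcomul_ten.
(* Evaluation at [l] makes both sides homomorphisms in the comultiplied [k], which may then be taken
   pure; the comultiplied [l] is treated the same way afterwards. *)
pose ev := @AlgHom T (walg_alg (conv L A)) (walg_alg A)
  (fun g : alg_hom L0 (walg_alg A) => g l) (fun _ _ _ _ _ => erefl).
suff /alg_hom_app /(_ (itcomul K n k)) :
  alg_cmp (alg_cmp (wact (walg_str A) w) (tpowm (fun i => f i : alg_hom (ten K0 L0) (walg_alg A))))
      (alg_cmp (tzip _ _ n) (purel _ (itcomul L n l))) =
  alg_cmp ev (alg_cmp (wact (walg_str (conv L A)) w)
      (tpowm (fun i => curry (f i) : alg_hom K0 (walg_alg (conv L A))))) by [].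
apply: tpow_ext => x.
rewrite /= tpowmE.
pose z i : conv L A := (curry (f i) : alg_hom K0 (walg_alg (conv L A))) (x i).
transitivity ((convop w z : alg_hom L0 (walg_alg A)) l);
  last exact: (alg_hom_app (esym (conv_wopE w z)) l).
suff /alg_hom_app /(_ (itcomul L n l)) :
  alg_cmp (alg_cmp (wact (walg_str A) w) (tpowm (fun i => f i : alg_hom (ten K0 L0) (walg_alg A))))
      (alg_cmp (tzip _ _ n) (purer _ (ptens x))) =
  alg_cmp (wact (walg_str A) w) (tpowm z) by [].
by apply: tpow_ext => y; rewrite /= tzipE !tpowmE.
Qed.

Lemma curry_ex (g : conv K (conv L A)) : exists f : conv (comon_ten K L) A,
  forall k l, (f : alg_hom (ten K0 L0) (walg_alg A)) (pure k l) =
    ((g : alg_hom K0 (walg_alg (conv L A))) k : alg_hom L0 (walg_alg A)) l.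
Proof. exact: (@uncurryP T K0 L0 (walg_alg A) g). Qed.

End ConvolutionTensor.

(** * Isomorphisms of co-algebras, and generating families *)

Section CoalgebraMorphisms.
Variables (T : comm_theory) (sym : bool) (W : operad sym).
Local Notation walg := (walg T W).
Local Notation UCo := (UCo T W).

Lemma whom_inv (A B : walg) (f : A -> B) (g : B -> A) :
  cancel f g -> cancel g f -> is_whom f -> is_whom g.
Proof.
move=> fK gK [fh fw]; split=> [n m o x j|n w x]; apply: (can_inj fK); rewrite gK.
- rewrite fh; apply: (congr1 (fun z => @aop T (walg_alg B) _ _ o z j)).
  by apply: funext => i; rewrite /= gK.
- by rewrite fw; congr wop; apply: funext => i; rewrite /= gK.
Qed.

(** Precomposition with [g] inverts precomposition with [f], and the inverse of a bijective
    homomorphism is a homomorphism; so [g] respects the co-structures automatically. *)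
Lemma coalg_iso (X Y : UCo) (f : hom X Y) (g : walg_hom (co_ob Y) (co_ob X)) :
  walg_cmp g (ch f) = walg_id _ -> walg_cmp (ch f) g = walg_id _ -> is_iso f.
Proof.
move=> gf fg; have gP A : @is_whom T sym W (Hom X A) (Hom Y A) (fun h => walg_cmp h g).
  apply: whom_inv (@ch_hom _ _ _ _ _ f A) => h; apply: walg_hom_ext => x /=.
  - by have /= -> := walg_hom_app fg x.
  - by have /= -> := walg_hom_app gf x.
by exists (CoAlgHom gP); split; apply: coalg_hom_eq.
Qed.

(** Generation is phrased as joint cancellation, which follows from universal properties without a
    description of elements. *)
Definition generating (X : walg) I (s : I -> X) : Prop :=
  forall A (u v : walg_hom X A), (forall i, u (s i) = v (s i)) -> u = v.

(** A morphism out of [tw X Y] is a morphism from [X] to [Hom Y A], so it is tested on [s] first and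
    then on [t]. *)
Lemma generating_tw (X Y : UCo) I J (s : I -> co_ob X) (t : J -> co_ob Y) :
  generating s -> generating t ->
  @generating (co_ob (tw X Y)) (I * J) (fun ij => odot (s ij.1) (t ij.2)).
Proof.
move=> sP tP A u v e; apply: tw_ext => x; apply: tw_ext_at.
apply: (congr1 (fun f : walg_hom X (Hom Y A) => f x)); apply: sP => i; apply: tP => j.
by rewrite !tw_phiE; exact: (e (i, j)).
Qed.

Lemma generating_twI : @generating (co_ob (twI T W)) unit (fun=> iI T W).
Proof. by move=> A u v e; apply: twI_ext; exact: (e tt). Qed.

End CoalgebraMorphisms.

(** * The lift of the free functor to co-algebras *)

Section LiftedFreeFunctor.
Variables (T : comm_theory) (sym : bool) (W : operad sym).
Local Notation U := (UAlg T W).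
Local Notation walg := (walg T W).
Local Notation Comon := (Comon (SV T) sym).
Local Notation UCo := (UCo T W).

Definition eta_UV (A : alg T) : alg_hom A (walg_alg (FUV T W A)) := ua_unit (free_UV W A).

Lemma generating_UV (A : alg T) : generating (eta_UV A).
Proof.
by move=> B u v e; apply: (ua_uniq (u := free_UV W A)); apply: alg_hom_ext.
Qed.

Lemma FUV_mapE (A B : alg T) (f : alg_hom A B) a :
  (fmap (FUV T W) (f : hom (A : VAlg T) B) : walg_hom _ _) (eta_UV A a) = eta_UV B (f a).
Proof. exact: (alg_hom_app (@ua_extE _ _ _ _ (free_UV W A) _ _) a). Qed.

Lemma convF_whom (K : Comon) (A B : walg) (g : walg_hom A B) :
  @is_whom T sym W (conv K A) (conv K B)
    (fun f : alg_hom (cm_ob K) (walg_alg A) => alg_cmp (fmap (forget_UV T W) g : alg_hom _ _) f).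
Proof. by apply: eq_is_whom (conv_map g (idm K)) => f; apply: alg_hom_ext. Qed.

Definition convF (K : Comon) : functor U U.
Proof.
apply: (@Functor U U (conv K) (fun A B g => WAlgHom (convF_whom K g))).
- by move=> A; apply: walg_hom_ext => f; apply: alg_hom_ext.
- by move=> A B C g f; apply: walg_hom_ext => h; apply: alg_hom_ext.
Defined.

Section LiftedFreeObject.
Variable K : Comon.
Notation K0 := (cm_ob K : alg T).

Definition FUV_restr A (h : walg_hom (FUV T W K0) A) : (convF K A : walg) :=
  alg_cmp (fmap (forget_UV T W) h : alg_hom _ _) (eta_UV K0).

Definition FUV_ext A (f : (convF K A : walg)) : walg_hom (FUV T W K0) A :=
  ua_ext (free_UV W K0) (Y := A : U) f.

Lemma FUV_restrK A : cancel (@FUV_restr A) (@FUV_ext A).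
Proof.
move=> h; apply: (ua_uniq (u := free_UV W K0)).
exact: (@ua_extE _ _ _ _ (free_UV W K0) A).
Qed.

Lemma FUV_extK A : cancel (@FUV_ext A) (@FUV_restr A).
Proof. move=> f; exact: (@ua_extE _ _ _ _ (free_UV W K0) A). Qed.

Lemma FUV_restr_nat A B (g : walg_hom A B) h :
  FUV_restr (walg_cmp g h) = (fmap (convF K) g : walg_hom _ _) (FUV_restr h).
Proof. exact: alg_hom_ext. Qed.

Definition hatFUV_ob : UCo := tr_coalg FUV_restrK FUV_extK FUV_restr_nat.

Definition FUV_restrH A : walg_hom (Hom hatFUV_ob A) (conv K A) :=
  WAlgHom (tr_phi FUV_restrK FUV_extK A).

Definition FUV_extH A : walg_hom (conv K A) (Hom hatFUV_ob A) :=
  WAlgHom (tr_psi FUV_restrK FUV_extK A).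

Definition eta_hat (k : K0) : co_ob hatFUV_ob := eta_UV K0 k.

Lemma FUV_restrHE A (h : walg_hom (co_ob hatFUV_ob) A) k :
  (FUV_restrH A h : alg_hom K0 (walg_alg A)) k = h (eta_hat k).
Proof. by []. Qed.

Lemma FUV_extHE A (f : conv K A) k :
  (FUV_extH A f : walg_hom (co_ob hatFUV_ob) A) (eta_hat k) = (f : alg_hom K0 (walg_alg A)) k.
Proof. by rewrite -FUV_restrHE; exact: (alg_hom_app (FUV_extK f) k). Qed.

Lemma generating_hat : generating eta_hat.
Proof. exact: generating_UV. Qed.

End LiftedFreeObject.

(** Through the bijections with convolution algebras this map becomes precomposition with [d], a
    homomorphism by [conv_map]. *)
Lemma hatFUV_map_hom (K L : Comon) (d : hom K L) A :
  @is_whom T sym W (Hom (hatFUV_ob L) A) (Hom (hatFUV_ob K) A)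
    (fun h => walg_cmp h (fmap (FUV T W) (cmh d) : walg_hom _ _)).
Proof.
have := wh_hom (walg_cmp (FUV_extH K A)
  (walg_cmp (WAlgHom (conv_map (walg_id A) d)) (FUV_restrH L A))).
apply: eq_is_whom => h; apply: generating_hat => k.
by rewrite -[LHS]/(FUV_extH K A _ _) FUV_extHE /= FUV_mapE.
Qed.

Definition hatFUV_map (K L : Comon) (d : hom K L) : hom (hatFUV_ob K) (hatFUV_ob L) :=
  @CoAlgHom T sym W (hatFUV_ob K) (hatFUV_ob L) (fmap (FUV T W) (cmh d)) (hatFUV_map_hom d).

Definition hatFUV : functor Comon UCo.
Proof.
apply: (@Functor Comon UCo hatFUV_ob hatFUV_map).
- by move=> K; apply: coalg_hom_eq; exact: (fmap1 (FUV T W)).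
- by move=> K L N g f; apply: coalg_hom_eq; exact: (fmapM (FUV T W)).
Defined.

Lemma hatFUV_mapE (K L : Comon) (d : hom K L) k :
  ch (fmap hatFUV d) (eta_hat k) = eta_hat (cmh d k).
Proof. exact: FUV_mapE. Qed.

Lemma hatFUV_lift : comp_functor (forget_co T W) hatFUV =
  comp_functor (FUV T W) (forget_comon (SV T) sym).
Proof. by congr Functor; apply: Prop_irrelevance. Qed.

End LiftedFreeFunctor.

(** * Comparison with the Tall-Wraith product *)

Section StrongMonoidality.
Variables (T : comm_theory) (sym : bool) (W : operad sym).
Local Notation walg := (walg T W).
Local Notation Comon := (Comon (SV T) sym).
Local Notation UCo := (UCo T W).
Local Notation hat := (hatFUV T W).
Local Notation eta := (eta_hat W).
Local Notation eta_pure K L k l := (@eta_hat T sym W (comon_ten K L) (pure k l)).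
Local Notation eta_one := (@eta_hat T sym W (comon_unit T sym) (eta_V T tt)).

Definition eta_tw (K L : Comon) (p : cm_ob K * cm_ob L) : co_ob (tw (hat K) (hat L)) :=
  odot (eta p.1) (eta p.2).

Lemma generating_eta_tw (K L : Comon) : generating (@eta_tw K L).
Proof. exact: (generating_tw (@generating_hat _ _ _ K) (@generating_hat _ _ _ L)). Qed.

Lemma generating_pure (K L : Comon) :
  @generating _ _ W (co_ob (hat (comon_ten K L))) (cm_ob K * cm_ob L)
    (fun p => eta_pure K L p.1 p.2).
Proof.
move=> A u v e; apply: generating_hat => x.
move: x; apply: (ten_extx (h := FUV_restr u) (k := FUV_restr v)) => k l.
exact: (e (k, l)).
Qed.

Lemma generating_unit :
  @generating _ _ W (co_ob (hat (comon_unit T sym))) unit (fun=> eta_one).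
Proof.
move=> A u v e; apply: generating_hat => x.
suff /alg_hom_app /(_ x) : FUV_restr u = FUV_restr v by [].
by apply: eta_extu; exact: (e tt).
Qed.

Lemma hat_mul_ex (K L : Comon) :
  exists h : coalg_hom (tw (hat K) (hat L)) (hat (comon_ten K L)),
    forall k l, h (odot (eta k) (eta l)) = eta_pure K L k l.
Proof.
(* Read from the innermost factor outwards: restrict to [K (x) L], curry, extend along [K], extend
   along [L] inside the hom, and uncurry by the universal property of [tw]. *)
pose th A : walg_hom (Hom (hat (comon_ten K L)) A) (Hom (tw (hat K) (hat L)) A) :=
  walg_cmp (tw_psi (hat K) (hat L) A)
    (walg_cmp (fmap (HomF (hat K))
        (FUV_extH L A : hom (conv L A : UAlg T W) (Hom (hat L) A : UAlg T W)) : walg_hom _ _)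
      (walg_cmp (FUV_extH K (conv L A))
        (walg_cmp (WAlgHom (curry_whom K L A)) (FUV_restrH (comon_ten K L) A)))).
have thE A (u : walg_hom (hat (comon_ten K L)) A) k l :
    (th A u : walg_hom _ _) (odot (eta k) (eta l)) = u (eta_pure K L k l).
  by rewrite /th -[LHS]/((tw_psi _ _ _ _ : walg_hom _ _) _) tw_psiE
    -[LHS]/((FUV_extH L A _ : walg_hom _ _) _) FUV_extHE FUV_extHE.
have thn A B (g : walg_hom A B) (u : walg_hom (hat (comon_ten K L)) A) :
    th B (walg_cmp g u) = walg_cmp g (th A u : walg_hom _ _) :> walg_hom _ _.
  apply: generating_eta_tw => -[k l].
  by rewrite /eta_tw thE -[RHS]/(g ((th A u : walg_hom _ _) _)) thE.
exists (yo thn) => k l; exact: (thE _ (walg_id _)).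
Qed.

Definition hat_mul (K L : Comon) : hom (tw (hat K) (hat L)) (hat (comon_ten K L)) :=
  sval (cid (hat_mul_ex K L)).

Lemma hat_mulE (K L : Comon) k l :
  ch (hat_mul K L) (odot (eta k) (eta l)) = eta_pure K L k l.
Proof. exact: (svalP (cid (hat_mul_ex K L))). Qed.

Lemma hat_mul_iso (K L : Comon) : is_iso (hat_mul K L).
Proof.
pose A := co_ob (tw (hat K) (hat L)).
(* [c] is the map sending [k] and [l] to [odot (eta k) (eta l)]; its uncurried form [f] extends to
   the inverse. *)
pose c : conv K (conv L A) := FUV_restrH K (conv L A)
  (walg_cmp (FUV_restrH L A) (tw_phi (hat K) (hat L) A (walg_id A) : walg_hom _ _)).
have [f fE] := curry_ex c.
have gE k l : (FUV_extH _ _ f : walg_hom (hat (comon_ten K L)) A) (eta_pure K L k l) =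
    odot (eta k) (eta l).
  by rewrite FUV_extHE fE.
apply: (coalg_iso (g := FUV_extH _ _ f : walg_hom (hat (comon_ten K L)) A)).
- by apply: generating_eta_tw => -[k l]; rewrite /= hat_mulE gE.
- by apply: generating_pure => -[k l]; rewrite /= gE hat_mulE.
Qed.

Lemma unit_grouplike : @grouplike T sym (comon_unit T sym) (eta_V T tt).
Proof. by []. Qed.

(** [twI] represents the identity functor, so Yoneda needs a natural homomorphism from the
    convolution algebra to [A]: evaluation at the group-like generator. *)
Lemma hat_unit_ex : exists h : coalg_hom (twI T W) (hat (comon_unit T sym)),
  h (iI T W) = eta_one.
Proof.
pose th A : walg_hom (Hom (hat (comon_unit T sym)) A) (Hom (twI T W) A) :=
  walg_cmp (twI_psi A) (walg_cmp (WAlgHom (conv_grouplike A unit_grouplike))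
    (FUV_restrH (comon_unit T sym) A)).
have thE A (u : walg_hom (hat (comon_unit T sym)) A) :
    (th A u : walg_hom _ _) (iI T W) = u (eta_one).
  by rewrite -[LHS]/((twI_psi _ _ : walg_hom _ _) _) twI_psiE.
have thn A B (g : walg_hom A B) (u : walg_hom (hat (comon_unit T sym)) A) :
    th B (walg_cmp g u) = walg_cmp g (th A u : walg_hom _ _) :> walg_hom _ _.
  by apply: twI_ext; rewrite thE -[RHS]/(g ((th A u : walg_hom _ _) _)) thE.
exists (yo thn); exact: (thE _ (walg_id _)).
Qed.

Definition hat_unit : hom (twI T W) (hat (comon_unit T sym)) := sval (cid hat_unit_ex).

Lemma hat_unitE : ch hat_unit (iI T W) = eta_one.
Proof. exact: (svalP (cid hat_unit_ex)). Qed.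

Lemma hat_unit_iso : is_iso hat_unit.
Proof.
have [f fE] := @eta_ex T unit (walg_alg (co_ob (twI T W))) (fun=> iI T W).
have gE : (FUV_extH (comon_unit T sym) _ f : walg_hom _ _) (eta_one) = iI T W.
  by rewrite FUV_extHE fE.
apply: (coalg_iso (g := FUV_extH (comon_unit T sym) _ f : walg_hom _ _)).
- by apply: generating_twI => _; rewrite /= hat_unitE gE.
- by apply: generating_unit => _; rewrite /= gE hat_unitE.
Qed.

Lemma coalg_idE (X : UCo) (x : co_ob X) : ch (idm X) x = x.
Proof. by []. Qed.

(** Every source is generated by [odot]-products of elements [eta k] and [iI], on which all
    structure maps are explicit; each law is checked there. *)
Lemma hatFUV_strong_monoidal : strong_monoidal (MComon T sym) (MUCo T W) hat.
Proof.
apply: (@StrongMonoidal _ _ (MComon T sym) (MUCo T W) hat hat_mul hat_unit).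
- move=> K K' L L' f g; apply: coalg_hom_eq; apply: generating_eta_tw => -[k l].
  rewrite /eta_tw -[LHS]/(ch (hat_mul _ _) (ch (tw_map _ _) _)) tw_mapE !hatFUV_mapE hat_mulE.
  rewrite -[RHS]/(ch (fmap hat _) (ch (hat_mul _ _) _)) hat_mulE hatFUV_mapE.
  by rewrite /= tenmE.
- exact: hat_mul_iso.
- exact: hat_unit_iso.
- move=> K L N; apply: coalg_hom_eq.
  apply: (generating_tw (@generating_eta_tw K L) (@generating_hat _ _ _ N)) => -[[k l] n].
  rewrite -[LHS]/(ch (fmap hat _) (ch (hat_mul _ _)
    (ch (tw_map _ _) (odot (odot (eta k) (eta l)) (eta n))))) tw_mapE.
  rewrite -[RHS]/(ch (hat_mul _ _)
    (ch (tw_map _ _) (ch (tw_assoc _ _ _) (odot (odot (eta k) (eta l)) (eta n))))) tw_assocE tw_mapE.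
  by rewrite !coalg_idE !hat_mulE !hatFUV_mapE /= ten_assocE.
- move=> K; apply: coalg_hom_eq.
  apply: (generating_tw (@generating_twI _ _ W) (@generating_hat _ _ _ K)) => -[u k].
  rewrite -[LHS]/(ch (fmap hat _) (ch (hat_mul _ _)
    (ch (tw_map _ _) (odot (iI T W) (eta k))))) tw_mapE.
  by rewrite coalg_idE hat_unitE hat_mulE !hatFUV_mapE tw_lunitE /= ten_lunitE.
- move=> K; apply: coalg_hom_eq.
  apply: (generating_tw (@generating_hat _ _ _ K) (@generating_twI _ _ W)) => -[k u].
  rewrite -[LHS]/(ch (fmap hat _) (ch (hat_mul _ _)
    (ch (tw_map _ _) (odot (eta k) (iI T W))))) tw_mapE.
  by rewrite coalg_idE hat_unitE hat_mulE !hatFUV_mapE tw_runitE /= ten_runitE.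
Qed.

End StrongMonoidality.

(** * The free comonoid on a set and the factorisation of the lifted free functor *)

Section FreeComonoid.
Variables (T : comm_theory) (sym : bool).

Local Notation FVmap X Y f :=
  (fmap (FV T) (f : hom (X : SET) (Y : SET)) : alg_hom (FV T X) (FV T Y)).
Local Notation comulF X :=
  (cm_mul (FV_comonoid_data T X) : alg_hom (FV T X) (ten (FV T X) (FV T X))).
Local Notation counitF X := (cm_unit (FV_comonoid_data T X) : alg_hom (FV T X) (tenunit T)).

Lemma FV_mapE (X Y : SET) (f : X -> Y) x : FVmap X Y f (eta_V T x) = eta_V T (f x).
Proof. exact: (congr1 (fun g => g x) (@ua_extE _ _ _ _ (@free_V T X) (FV T Y) _)). Qed.

Lemma FV_comulE (X : SET) (x : X) : comulF X (eta_V T x) = pure (eta_V T x) (eta_V T x).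
Proof.
rewrite -[LHS]/((FV_prod T X X : alg_hom _ _) (FVmap X (X * X)%type _ (eta_V T x))) FV_mapE.
exact: (svalP (cid (FV_prodP T X X))).
Qed.

Lemma FV_counitE (X : SET) (x : X) : counitF X (eta_V T x) = eta_V T tt.
Proof. exact: FV_mapE. Qed.

(** All laws are checked on generators, which are group-like; this includes cocommutativity, so
    either value of [sym] is allowed. *)
Definition FV_comonoid (X : SET) : Comon (SV T) sym.
Proof.
apply: (@Comonoid _ _ (SV T) sym (FV_comonoid_data T X)).
- apply: eta_ext => x.
  rewrite -[LHS]/(ten_assoc _ _ _ (tenm (comulF X) (alg_id _) (comulF X _))).
  rewrite -[RHS]/(tenm (alg_id _) (comulF X) (comulF X _)).
  by rewrite !FV_comulE !tenmE !FV_comulE ten_assocE.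
- apply: eta_ext => x.
  rewrite -[LHS]/(ten_lunit _ (tenm (counitF X) (alg_id _) (comulF X _))).
  by rewrite FV_comulE tenmE FV_counitE ten_lunitE.
- apply: eta_ext => x.
  rewrite -[LHS]/(ten_runit _ (tenm (alg_id _) (counitF X) (comulF X _))).
  by rewrite FV_comulE tenmE FV_counitE ten_runitE.
- move=> _; apply: eta_ext => x.
  by rewrite -[LHS]/(ten_swap _ _ (comulF X _)) FV_comulE ten_swapE.
Defined.

Definition FV_comonoid_map (X Y : SET) (f : hom X Y) : hom (FV_comonoid X) (FV_comonoid Y).
Proof.
apply: (@ComonoidHom _ (MV T) (FV_comonoid_data T X) (FV_comonoid_data T Y) (fmap (FV T) f)).
- apply: eta_ext => x.
  rewrite -[LHS]/(comulF Y (FVmap X Y f _)).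
  rewrite -[RHS]/(tenm (FVmap X Y f) (FVmap X Y f) (comulF X _)).
  by rewrite FV_mapE !FV_comulE tenmE FV_mapE.
- apply: eta_ext => x.
  rewrite -[LHS]/(counitF Y (FVmap X Y f _)) -[RHS]/(counitF X _).
  by rewrite FV_mapE !FV_counitE.
Defined.

Definition FV_hat : functor SET (Comon (SV T) sym).
Proof.
apply: (@Functor SET (Comon (SV T) sym) FV_comonoid FV_comonoid_map).
- by move=> X; apply: comonoid_hom_ext; exact: (fmap1 (FV T)).
- by move=> X Y Z g f; apply: comonoid_hom_ext; exact: (fmapM (FV T)).
Defined.

Lemma FV_hat_lift : comp_functor (forget_comon (SV T) sym) FV_hat = FV T.
Proof. by rewrite /FV /left_adjoint; congr Functor; apply: Prop_irrelevance. Qed.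

Lemma FV_grouplike (X : SET) (x : X) : @grouplike T sym (FV_comonoid X) (eta_V T x).
Proof. by split; [exact: FV_comulE|exact: FV_counitE]. Qed.

Variable W : operad sym.
Local Notation hat := (hatFUV T W).

Lemma generating_FV_hat (X : SET) :
  @generating _ _ W (co_ob (hat (FV_hat X))) X
    (fun x => eta_hat W (K := FV_hat X) (eta_V T x)).
Proof.
move=> A u v e; apply: generating_hat => x.
suff /alg_hom_app /(_ x) : FUV_restr u = FUV_restr v by [].
by apply: eta_ext => y; exact: (e y).
Qed.

Lemma generating_hatFU (X : SET) : @generating _ _ W (co_ob (hatFU T W X)) X (@eta_U T sym W X).
Proof.
by move=> A u v e; apply: (ua_uniq (u := free_US T W X)); apply: funext => x; exact: e.
Qed.

Lemma hatFU_mapE (X Y : SET) (f : X -> Y) x :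
  ch (fmap (hatFU T W) (f : hom X Y)) (eta_U T W x) = eta_U T W (f x).
Proof. exact: (congr1 (fun g => g x) (@ua_extE _ _ _ _ (free_US T W X) _ _)). Qed.

(** Since generators are group-like, evaluation at all of them is a homomorphism from the
    convolution algebra to the power of [A] by [X], which carries the structure of [hatFU]; Yoneda
    applies. *)
Lemma hatFU_compare_ex (X : SET) : exists h : coalg_hom (hatFU T W X) (hat (FV_hat X)),
  forall x, h (eta_U T W x) = eta_hat W (K := FV_hat X) (eta_V T x).
Proof.
have evP A : @is_whom T sym W (conv (FV_hat X) A) (walg_pow A X)
    (fun (f : alg_hom (FV T X) (walg_alg A)) x => f (eta_V T x)).
  by apply: walg_pow_hom => x; exact: (conv_grouplike A (FV_grouplike x)).
pose th A : walg_hom (Hom (hat (FV_hat X)) A) (Hom (hatFU T W X) A) :=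
  walg_cmp (WAlgHom (tr_psi (@hatFU_phiK T sym W X) (@hatFU_psiK T sym W X) A))
    (walg_cmp (WAlgHom (evP A)) (FUV_restrH (FV_hat X) A)).
have thE A (u : walg_hom (hat (FV_hat X)) A) x :
    (th A u : walg_hom (hatFU T W X) A) (eta_U T W x) =
    u (eta_hat W (K := FV_hat X) (eta_V T x)).
  exact: (congr1 (fun g => g x) (@ua_extE _ _ _ _ (free_US T W X) A _)).
have thn A B (g : walg_hom A B) (u : walg_hom (hat (FV_hat X)) A) :
    th B (walg_cmp g u) = walg_cmp g (th A u : walg_hom _ _) :> walg_hom _ _.
  apply: generating_hatFU => x.
  by rewrite thE -[RHS]/(g ((th A u : walg_hom _ _) _)) thE.
exists (yo thn) => x; exact: (thE _ (walg_id _)).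
Qed.

Definition hatFU_compare (X : SET) : hom (hatFU T W X) (hat (FV_hat X)) :=
  sval (cid (hatFU_compare_ex X)).

Lemma hatFU_compareE (X : SET) x :
  ch (hatFU_compare X) (eta_U T W x) = eta_hat W (K := FV_hat X) (eta_V T x).
Proof. exact: (svalP (cid (hatFU_compare_ex X))). Qed.

Lemma hatFU_compare_iso (X : SET) : is_iso (hatFU_compare X).
Proof.
(* The inverse extends [eta_U] first linearly to [FV T X] and then to the free algebra on it. *)
have [f fE] := @eta_ex T X (walg_alg (co_ob (hatFU T W X))) (@eta_U T sym W X).
have gE x : (FUV_extH (FV_hat X) _ f : walg_hom _ _) (eta_hat W (K := FV_hat X) (eta_V T x)) =
    eta_U T W x.
  by rewrite FUV_extHE fE.
apply: (coalg_iso (g := FUV_extH (FV_hat X) _ f : walg_hom _ _)).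
- by apply: generating_hatFU => x; rewrite /= hatFU_compareE gE.
- by apply: generating_FV_hat => x; rewrite /= gE hatFU_compareE.
Qed.

Lemma hatFU_factors : nat_iso (hatFU T W) (comp_functor hat FV_hat).
Proof.
apply: (@NatIso _ _ (hatFU T W) (comp_functor hat FV_hat) hatFU_compare); last first.
  exact: hatFU_compare_iso.
move=> X Y f; apply: coalg_hom_eq.
apply: generating_hatFU => x.
rewrite -[LHS]/(ch (hatFU_compare Y) (ch (fmap (hatFU T W) f) _)) hatFU_mapE.
rewrite -[RHS]/(ch (fmap hat (fmap FV_hat f)) (ch (hatFU_compare X) _)).
by rewrite !hatFU_compareE hatFUV_mapE FV_mapE.
Qed.

End FreeComonoid.

Theorem proposition5p11 (T : comm_theory) (sym : bool) (W : operad sym) :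
  exists Fhat : functor (Comon (SV T) sym) (UCo T W),
    comp_functor (forget_co T W) Fhat =
      comp_functor (FUV T W) (forget_comon (SV T) sym) /\
    inhabited (strong_monoidal (MComon T sym) (MUCo T W) Fhat) /\
    exists FVhat : functor SET (Comon (SV T) sym),
      comp_functor (forget_comon (SV T) sym) FVhat = FV T /\
      (forall X : SET, cm_data (FVhat X : comonoid (SV T) sym) = FV_comonoid_data T X) /\
      inhabited (nat_iso (hatFU T W) (comp_functor Fhat FVhat)).
Proof.
exists (hatFUV T W); split; first exact: hatFUV_lift.
split; first exact: (inhabits (hatFUV_strong_monoidal T W)).
exists (FV_hat T sym); split; first exact: FV_hat_lift.
by split=> //; exact: (inhabits (hatFU_factors T W)).
Qed.
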